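(* There is no lifting, with respect to the functor $\mathrm{V}$, of the diagram $\vec{D}$ by any (commutative, $\{0,1\}^3$-indexed) diagram of regular rings and ring homomorphisms, and there is no lifting, with respect to $\mathrm{V}$, of $\vec{D}$ by any (commutative, $\{0,1\}^3$-indexed) diagram of C*-algebras of real rank $0$ and C*-homomorphisms.
   Context: Rings and C*-algebras are not necessarily unital; homomorphisms need not preserve units. A ring $R$ is regular if for each $x\in R$ there is $y\in R$ with $xyx=x$. $\mathbb{Z}^+=\{0,1,2,\dots\}$. A diagram $\vec{R}$ lifts $\vec{D}$ with respect to $\mathrm{V}$ if $\mathrm{V}\vec{R}$ is naturally isomorphic to $\vec{D}$. The diagram $\vec{D}$: it is the commutative diagram of commutative monoids indexed by the cube $\{0,1\}^3$ with vertices $\boldsymbol{A}=\boldsymbol{B}=\mathbb{Z}^+$ (bottom and top) and $\boldsymbol{A}_j=\boldsymbol{B}_j=\mathbb{Z}^+\times\mathbb{Z}^+$ for $j\in\{0,1,2\}$. Let $\boldsymbol{e}(x)=(x,x)$, $\boldsymbol{s}(x,y)=(y,x)$, $\boldsymbol{h}(x,y)=x+y$. The arrows are: $\boldsymbol{e}\colon\boldsymbol{A}\to\boldsymbol{A}_j$ for each $j$; the identity maps $\boldsymbol{A}_0\to\boldsymbol{B}_2$, $\boldsymbol{A}_0\to\boldsymbol{B}_1$, $\boldsymbol{A}_1\to\boldsymbol{B}_0$, $\boldsymbol{A}_2\to\boldsymbol{B}_1$, $\boldsymbol{A}_2\to\boldsymbol{B}_0$; the map $\boldsymbol{s}\colon\boldsymbol{A}_1\to\boldsymbol{B}_2$;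 and $\boldsymbol{h}\colon\boldsymbol{B}_j\to\boldsymbol{B}$ for each $j$. For a ring $R$, $\mathrm{V}(R)$ is the commutative monoid of equivalence classes $[a]_R$ of idempotents $a$ of $\mathrm{M}_\infty(R)=\bigcup_n\mathrm{M}_n(R)$ (embedding $\mathrm{M}_n(R)$ into $\mathrm{M}_{n+1}(R)$ by adding a zero row and column), where $a\sim b$ if $a=xy$, $b=yx$ for some $x,y\in\mathrm{M}_\infty(R)$, with addition determined by $[a]_R+[b]_R=[a+b]_R$ whenever $ab=ba=0$. A ring homomorphism $f\colon R\to S$ induces $\mathrm{V}(f)\colon[a]_R\mapsto[f(a)]_S$. *)

(* Defs.v *)
From HB Require Import structures.
From mathcomp Require Import all_boot all_order all_algebra.
From mathcomp Require Import all_classical all_reals all_analysis.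
From mathcomp Require Import complex zify.

Set Implicit Arguments.
Unset Strict Implicit.
Unset Printing Implicit Defensive.

Import Order.TTheory GRing.Theory Num.Theory.
Import numFieldNormedType.Exports.

Local Open Scope classical_set_scope.
Local Open Scope complex_scope.
Local Open Scope ring_scope.

Reserved Notation "x ** y" (at level 40, left associativity).
Notation "x ** y" := (x * y)%g : ring_scope.

HB.mixin Record Zmodule_Semigroup_isRng R of GRing.Zmodule R & Semigroup R := {
  rmulDl : forall x y z : R, (x + y) ** z = x ** z + y ** z;
  rmulDr : forall x y z : R, x ** (y + z) = x ** y + x ** z
}.

#[short(type="rngType")]
HB.structure Definition Rng :=
  {R of GRing.Zmodule R & Semigroup R & Zmodule_Semigroup_isRng R}.

HB.structure Definition RngMorphism (R S : rngType) :=
  {f of @GRing.Additive R S f & @Multiplicative R S f}.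

Notation "{ 'rngmorphism' R -> S }" := (RngMorphism.type R%type S%type)
  (at level 0, R at level 98, format "{ 'rngmorphism'  R  ->  S }") : type_scope.

Definition regular_rng (R : rngType) : Prop :=
  forall x : R, exists y : R, x ** y ** x = x.

Definition is_rng_unit (R : rngType) (e : R) : Prop :=
  forall x : R, e ** x = x /\ x ** e = x.

Section RngTheory.
Variable R : rngType.
Implicit Types x y z : R.

Lemma rmulA x y z : x ** (y ** z) = x ** y ** z.
Proof. exact: mulgA. Qed.

Lemma rmul0l x : 0 ** x = 0.
Proof. by apply: (addrI (0 ** x)); rewrite -rmulDl !addr0. Qed.

Lemma rmul0r x : x ** 0 = 0.
Proof. by apply: (addrI (x ** 0)); rewrite -rmulDr !addr0. Qed.

Lemma rmul_suml n (F : 'I_n -> R) x :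
  (\sum_(i < n) F i) ** x = \sum_(i < n) F i ** x.
Proof. by apply: (big_morph (fun y => y ** x)) => [y z|]; rewrite ?rmulDl ?rmul0l. Qed.

Lemma rmul_sumr n (F : 'I_n -> R) x :
  x ** (\sum_(i < n) F i) = \sum_(i < n) x ** F i.
Proof. by apply: (big_morph (fun y => x ** y)) => [y z|]; rewrite ?rmulDr ?rmul0r. Qed.

End RngTheory.

(* M_oo(R), the union of the M_n(R), is the ring of nat-indexed matrices that
   vanish outside some upper left n x n corner. *)

Section FiniteMatrices.
Variable R : rngType.

Definition finite_mx : {pred nat -> nat -> R} :=
  [pred a : nat -> nat -> R |
    `[< exists n, forall i j, (n <= i)%N || (n <= j)%N -> a i j = 0 >]].

Lemma finite_mx_zmod_closed : zmod_closed finite_mx.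
Proof.
split=> [|a b /asboolP[m am] /asboolP[n bn]]; first by apply/asboolP; exists 0.
apply/asboolP; exists (maxn m n) => i j; rewrite !geq_max => ij.
have -> : (a - b) i j = a i j - b i j by [].
by rewrite am ?bn ?subr0//; lia.
Qed.

HB.instance Definition _ :=
  GRing.isZmodClosed.Build (nat -> nat -> R) finite_mx finite_mx_zmod_closed.

Record Minf := MkMinf { Minf_fun :> nat -> nat -> R; _ : Minf_fun \in finite_mx }.

HB.instance Definition _ := [isSub for Minf_fun].
HB.instance Definition _ := [Choice of Minf by <:].
HB.instance Definition _ := [SubChoice_isSubZmodule of Minf by <:].

Implicit Types a b c : Minf.

Lemma MinfP a b : (forall i j, a i j = b i j) -> a = b.
Proof. by move=> ab; apply/val_inj/funext => i; apply/funext => j. Qed.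

Lemma Minf_bound a : exists n, forall i j, (n <= i)%N || (n <= j)%N -> a i j = 0.
Proof. by case: a => a /= /asboolP. Qed.

Definition mulM_fun (a b : nat -> nat -> R) (i j : nat) : R :=
  \sum_(k \in [set: nat]) a i k ** b k j.

Lemma fsum_bounded n (F : nat -> R) : (forall k, (n <= k)%N -> F k = 0) ->
  \sum_(k \in [set: nat]) F k = \sum_(k < n) F k.
Proof.
move=> Fn; rewrite fsbig_ord; apply/esym/fsbig_widen => //= k [_ /= /negP].
by rewrite -leqNgt => /Fn.
Qed.

Lemma mulM_finite a b : mulM_fun a b \in finite_mx.
Proof.
have [m am] := Minf_bound a; have [n bn] := Minf_bound b.
apply/asboolP; exists (maxn m n) => i j; rewrite !geq_max => ij.
apply: fsbig1 => k _.
have [mi|im] := leqP m i; first by rewrite am ?mi// rmul0l.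
by rewrite bn ?rmul0r//; lia.
Qed.

Definition mulM a b : Minf := MkMinf (mulM_finite a b).

Lemma mulM_bound a : exists n, forall N, (n <= N)%N ->
  (forall b i j, mulM a b i j = \sum_(k < N) a i k ** b k j) /\
  (forall b i j, mulM b a i j = \sum_(k < N) b i k ** a k j).
Proof.
have [n an] := Minf_bound a; exists n => N nN; split=> b i j;
  by apply: fsum_bounded => k Nk; rewrite an ?rmul0l ?rmul0r// (leq_trans nN Nk) ?orbT.
Qed.

Lemma mulM_assoc : associative mulM.
Proof.
move=> a b c; have [n an] := mulM_bound a; have [m cm] := mulM_bound c.
have [an1 _] := an _ (leqnn n); have [_ cm1] := cm _ (leqnn m).
apply: MinfP => i j; rewrite an1 cm1.
under eq_bigr do rewrite cm1 rmul_sumr.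
under [RHS]eq_bigr do rewrite an1 rmul_suml.
rewrite exchange_big; apply: eq_bigr => k _; apply: eq_bigr => l _.
by rewrite rmulA.
Qed.

HB.instance Definition _ := isSemigroup.Build Minf mulM_assoc.

Lemma MinfDE a b i j : (a + b) i j = a i j + b i j. Proof. by []. Qed.

Lemma MinfME a b : a ** b = mulM a b. Proof. by []. Qed.

Lemma mulM_Dl a b c : mulM (a + b) c = mulM a c + mulM b c.
Proof.
have [n cn] := mulM_bound c; have [_ E] := cn _ (leqnn n).
apply: MinfP => i j; rewrite MinfDE !E -big_split/=.
by apply: eq_bigr => k _; rewrite -rmulDl.
Qed.

Lemma mulM_Dr a b c : mulM a (b + c) = mulM a b + mulM a c.
Proof.
have [n an] := mulM_bound a; have [E _] := an _ (leqnn n).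
apply: MinfP => i j; rewrite MinfDE !E -big_split/=.
by apply: eq_bigr => k _; rewrite -rmulDr.
Qed.

HB.instance Definition _ :=
  Zmodule_Semigroup_isRng.Build Minf mulM_Dl mulM_Dr.

End FiniteMatrices.

Section MvN.
Variable S : rngType.
Implicit Types x y : S.

Definition mvn (a b : S) : Prop := exists x y, a = x ** y /\ b = y ** x.

Record idem := MkIdem { ival : S; _ : ival ** ival == ival }.

HB.instance Definition _ := [isSub for ival].
HB.instance Definition _ := [Choice of idem by <:].

Lemma idemE (a : idem) : ival a ** ival a = ival a.
Proof. by case: a => a /= /eqP. Qed.

Definition mvn_rel : rel idem := fun a b => `[< mvn (ival a) (ival b) >].

Lemma mvn_refl : reflexive mvn_rel.
Proof. by move=> a; apply/asboolP; exists (ival a), (ival a); rewrite idemE. Qed.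

Lemma mvn_sym : symmetric mvn_rel.
Proof.
by move=> a b; apply/idP/idP => /asboolP[x [y [ax bx]]];
  apply/asboolP; exists y, x.
Qed.

Lemma mvn_trans : transitive mvn_rel.
Proof.
move=> b a c /asboolP[x [y [ax bx]]] /asboolP[u [v [bu cu]]].
apply/asboolP; exists (x ** u), (v ** y); split.
  by rewrite rmulA -(rmulA x) -bu bx rmulA -(rmulA (x ** y)) -ax idemE.
by rewrite rmulA -(rmulA v) -bx bu rmulA -(rmulA (v ** u)) -cu idemE.
Qed.

Lemma mvn_idem_trans (a b c : idem) :
  mvn (ival a) (ival b) -> mvn (ival b) (ival c) -> mvn (ival a) (ival c).
Proof. by move=> ab bc; apply/asboolP/(@mvn_trans b); apply/asboolP. Qed.

Canonical mvn_equiv := EquivRel mvn_rel mvn_refl mvn_sym mvn_trans.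

Lemma mvn_normalize a b : a ** a = a -> b ** b = b -> mvn a b ->
  exists x y, [/\ a = x ** y, b = y ** x, x ** b = x & b ** y = y].
Proof.
move=> aa bb [x [y [ax bx]]]; exists (a ** x), (y ** a); split.
- by rewrite rmulA -(rmulA _ x) -ax !aa.
- by rewrite rmulA -(rmulA y) aa ax rmulA -rmulA -bx bb.
- by rewrite bx rmulA -(rmulA _ x) -ax aa.
- by rewrite bx rmulA -(rmulA y) -ax -rmulA aa.
Qed.

Lemma mvn_add a b a' b' :
  a ** a = a -> b ** b = b -> a' ** a' = a' -> b' ** b' = b' ->
  mvn a a' -> mvn b b' -> a' ** b' = 0 -> b' ** a' = 0 ->
  a ** b = 0 -> b ** a = 0 -> mvn (a + b) (a' + b').
Proof.
move=> aa bb a'a' b'b' /mvn_normalize-/(_ aa a'a')[x [y [axy a'yx xa' a'y]]].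
move=> /mvn_normalize-/(_ bb b'b')[u [v [buv b'vu ub' b'v]]] a'b' b'a' ab ba.
have ya : y ** a = y by rewrite axy rmulA -a'yx.
have vb : v ** b = v by rewrite buv rmulA -b'vu.
have ax : a ** x = x by rewrite axy -rmulA -a'yx.
have bu : b ** u = u by rewrite buv -rmulA -b'vu.
have yu : y ** u = 0 by rewrite -ya -bu -rmulA (rmulA a) ab rmul0l rmul0r.
have vx : v ** x = 0 by rewrite -vb -ax -rmulA (rmulA b) ba rmul0l rmul0r.
exists (x + u), (y + v); split; rewrite rmulDl !rmulDr.
  have -> : x ** v = 0 by rewrite -xa' -b'v -rmulA (rmulA a') a'b' rmul0l rmul0r.
  have -> : u ** y = 0 by rewrite -ub' -a'y -rmulA (rmulA b') b'a' rmul0l rmul0r.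
  by rewrite addr0 add0r axy buv.
by rewrite yu vx addr0 add0r a'yx b'vu.
Qed.

Lemma idem0_subproof : (0 : S) ** 0 == 0.
Proof. by rewrite rmul0l. Qed.

Definition idem0 : idem := MkIdem idem0_subproof.

Lemma idem_add_subproof (a b : idem) :
  ival a ** ival b = 0 -> ival b ** ival a = 0 ->
  (ival a + ival b) ** (ival a + ival b) == ival a + ival b.
Proof. by move=> ab ba; rewrite rmulDl !rmulDr !idemE ab ba addr0 add0r. Qed.

Definition idem_add (a b : idem) (ab : ival a ** ival b = 0)
    (ba : ival b ** ival a = 0) : idem :=
  MkIdem (idem_add_subproof ab ba).

End MvN.

Section IdemMap.
Variables (S T : rngType) (f : {rngmorphism S -> T}).

Lemma rmorphMg (x y : S) : f (x ** y) = f x ** f y.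
Proof. exact: gmulfM. Qed.

Lemma idem_map_subproof (a : idem S) : f (ival a) ** f (ival a) == f (ival a).
Proof. by rewrite -rmorphMg idemE. Qed.

Definition idem_map (a : idem S) : idem T := MkIdem (idem_map_subproof a).

Lemma mvn_map (x y : S) : mvn x y -> mvn (f x) (f y).
Proof. by move=> [u [v [-> ->]]]; exists (f u), (f v); rewrite !rmorphMg. Qed.

End IdemMap.

(* The addition of V(R) is defined on representatives by placing them on the
   even and on the odd indices, which makes them orthogonal; see [V_addE] for
   the formula [a] + [b] = [a + b] for orthogonal a and b. *)
Section Reindexing.
Variable R : rngType.
Implicit Types a b : Minf R.

Variant part := All | Even | Odd.

Definition part_index (s : part) (i : nat) : option nat :=
  match s with
  | All => Some i
  | Even => if odd i then None else Some i./2
  | Odd => if odd i then Some i./2 else None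
  end.

Definition spread_fun (s t : part) (a : nat -> nat -> R) (i j : nat) : R :=
  match part_index s i, part_index t j with
  | Some i', Some j' => a i' j'
  | _, _ => 0
  end.

Lemma spread_finite s t a : spread_fun s t a \in @finite_mx R.
Proof.
have [n an] := Minf_bound a; apply/asboolP; exists n.*2.+1 => i j ij.
rewrite /spread_fun; case: s t => [] []/=; do ?case: (boolP (odd _)) => // ?;
  rewrite ?an//; lia.
Qed.

Definition spread s t a : Minf R := MkMinf (spread_finite s t a).

Lemma sum_part s n (F : nat -> R) : (forall k, (n <= k)%N -> F k = 0) ->
  \sum_(k \in [set: nat]) (if part_index s k is Some k' then F k' else 0) =
  \sum_(k \in [set: nat]) F k.
Proof.
move=> Fn; case: s => //=; rewrite (fsum_bounded Fn) (@fsum_bounded _ n.*2) => [|k nk].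
- elim: n {Fn} => [|n IH]; first by rewrite !big_ord0.
  by rewrite doubleS !big_ord_recr/= IH /= odd_double/= doubleK addr0.
- by case: ifP => // _; apply: Fn; lia.
- elim: n {Fn} => [|n IH]; first by rewrite !big_ord0.
  by rewrite doubleS !big_ord_recr/= IH /= odd_double/= uphalf_double addr0.
- by case: ifP => // _; apply: Fn; lia.
Qed.

Lemma spreadM s t u a b : spread s t a ** spread t u b = spread s u (a ** b).
Proof.
have [n an] := Minf_bound a; apply: MinfP => i j.
rewrite !MinfME /mulM /= /mulM_fun /spread_fun.
case: (part_index s i) => [i'|]; last by rewrite fsbig1// => k _; rewrite rmul0l.
case: (part_index u j) => [j'|]; last first.
  by rewrite fsbig1// => k _; case: (part_index t k) => *; rewrite rmul0r.
rewrite /mulM_fun -[RHS](@sum_part t n) => [|k nk]; last first.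
  by rewrite /= an ?nk ?orbT// rmul0l.
by apply: eq_fsbigr => k _; case: (part_index t k) => //; rewrite rmul0l.
Qed.

Lemma spread_orth s u a b :
  (spread s Even a ** spread Odd u b = 0) * (spread s Odd a ** spread Even u b = 0).
Proof.
split; apply: MinfP => i j; rewrite MinfME/= /mulM_fun fsbig1// => k _;
  rewrite /spread_fun /=; case: (odd k); case: (part_index s i) => *;
  case: (part_index u j) => *; by rewrite ?rmul0l ?rmul0r.
Qed.

Lemma spread0 s t : spread s t 0 = 0.
Proof.
by apply: MinfP => i j; rewrite /= /spread_fun; case: part_index => // ?;
  case: part_index.
Qed.

Lemma spread_All a : spread All All a = a.
Proof. exact: MinfP. Qed.

Lemma spread_idem_subproof s (a : idem (Minf R)) :
  spread s s (ival a) ** spread s s (ival a) == spread s s (ival a).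
Proof. by rewrite spreadM idemE. Qed.

Definition spread_idem s (a : idem (Minf R)) : idem (Minf R) :=
  MkIdem (spread_idem_subproof s a).

Lemma mvn_spread s (a : idem (Minf R)) : mvn (ival (spread_idem s a)) (ival a).
Proof.
by exists (spread s All (ival a)), (spread All s (ival a)); rewrite !spreadM spread_All/= !idemE.
Qed.

Definition dsum (a b : idem (Minf R)) : idem (Minf R) :=
  @idem_add _ (spread_idem Even a) (spread_idem Odd b)
    (spread_orth _ _ _ _).1 (spread_orth _ _ _ _).2.

Lemma mvn_dsum (a b c d : idem (Minf R)) :
  mvn (ival a) (ival c) -> mvn (ival b) (ival d) ->
  ival c ** ival d = 0 -> ival d ** ival c = 0 ->
  mvn (ival (dsum a b)) (ival c + ival d).
Proof.
move=> ac bd cd dc; apply: mvn_add; rewrite ?idemE ?spread_orth//.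
- exact: mvn_idem_trans (mvn_spread Even a) ac.
- exact: mvn_idem_trans (mvn_spread Odd b) bd.
Qed.

End Reindexing.

Section V.
Variable R : rngType.
Implicit Types (a b c : idem (Minf R)).

Definition V : Type := {eq_quot (mvn_equiv (Minf R))}%qT.

HB.instance Definition _ := Choice.on V.
HB.instance Definition _ := Quotient.on V.

Definition Vclass a : V := (\pi_V a)%qT.

Lemma VclassP a b : Vclass a = Vclass b <-> mvn (ival a) (ival b).
Proof.
rewrite /Vclass; split=> [/eqP|ab].
  by rewrite piE => /asboolP.
by apply/eqP; rewrite piE; apply/asboolP.
Qed.

Lemma VreprP (u : V) : Vclass (repr u) = u.
Proof. exact: reprK. Qed.

Lemma mvn_repr a : mvn (ival (repr (Vclass a))) (ival a).
Proof. by apply/VclassP; rewrite VreprP. Qed.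

Definition Vadd (u v : V) : V := Vclass (dsum (repr u) (repr v)).

Lemma Vadd_class a b (ab : ival a ** ival b = 0) (ba : ival b ** ival a = 0) :
  Vadd (Vclass a) (Vclass b) = Vclass (idem_add ab ba).
Proof. by apply/VclassP; apply: mvn_dsum => //; apply: mvn_repr. Qed.

Lemma Vclass_spread s a : Vclass (spread_idem s a) = Vclass a.
Proof. by apply/VclassP; apply: mvn_spread. Qed.

Lemma VaddC : commutative Vadd.
Proof.
move=> u v; rewrite -(VreprP u) -(VreprP v).
rewrite -(Vclass_spread Even (repr u)) -(Vclass_spread Odd (repr v)).
rewrite !Vadd_class ?spread_orth// => *; congr Vclass.
by apply: val_inj; rewrite /= addrC.
Qed.

Lemma VaddA : associative Vadd.
Proof.
move=> u v w; rewrite -(VreprP u) -(VreprP v) -(VreprP w).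
set a := repr u; set b := repr v; set c := repr w.
rewrite -(Vclass_spread Even a).
rewrite -(Vclass_spread Even b) -(Vclass_spread Odd (spread_idem Even b)).
rewrite -(Vclass_spread Odd c) -(Vclass_spread Odd (spread_idem Odd c)).
rewrite !Vadd_class /= ?rmulDl ?rmulDr ?spreadM ?spread_orth ?spread0 ?addr0//.
move=> *; rewrite !Vadd_class /= ?rmulDl ?rmulDr ?spreadM ?spread_orth ?spread0 ?addr0//.
by move=> *; congr Vclass; apply: val_inj; rewrite /= addrA.
Qed.

Definition V0 : V := Vclass (idem0 (Minf R)).

Lemma Vadd0 : left_id V0 Vadd.
Proof.
move=> u; rewrite -[in RHS](VreprP u) -{1}(VreprP u) /V0.
rewrite Vadd_class /= ?rmul0l ?rmul0r// => *; congr Vclass.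
by apply: val_inj; rewrite /= add0r.
Qed.

HB.instance Definition _ := GRing.isNmodule.Build V VaddA VaddC Vadd0.

Lemma V_addE a b (ab : ival a ** ival b = 0) (ba : ival b ** ival a = 0) :
  Vclass a + Vclass b = Vclass (idem_add ab ba).
Proof. exact: Vadd_class. Qed.

End V.

Section VFunctor.
Variables (R S : rngType) (f : {rngmorphism R -> S}).

Lemma Minf_map_finite (a : Minf R) : (fun i j => f (a i j)) \in @finite_mx S.
Proof.
have [n an] := Minf_bound a; apply/asboolP; exists n => i j ij.
by rewrite an// raddf0.
Qed.

Definition Minf_map (a : Minf R) : Minf S := MkMinf (Minf_map_finite a).

Lemma Minf_map_is_nmod_morphism : nmod_morphism Minf_map.
Proof. by split=> [|a b]; apply: MinfP => i j /=; rewrite ?raddf0 ?raddfD. Qed.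

Lemma Minf_map_is_multiplicative (a b : Minf R) :
  Minf_map (a ** b) = Minf_map a ** Minf_map b.
Proof.
have [m am] := mulM_bound a; have [n an] := mulM_bound (Minf_map a).
have [aM _] := am _ (leq_maxl m n); have [aN _] := an _ (leq_maxr m n).
apply: MinfP => i j.
have -> : Minf_map (a ** b) i j = f (mulM a b i j) by [].
rewrite aM MinfME aN raddf_sum.
by apply: eq_bigr => k _; exact: (rmorphMg f).
Qed.

HB.instance Definition _ :=
  GRing.isNmodMorphism.Build (Minf R) (Minf S) Minf_map Minf_map_is_nmod_morphism.
HB.instance Definition _ :=
  isMultiplicative.Build (Minf R) (Minf S) Minf_map Minf_map_is_multiplicative.

Definition V_map (u : V R) : V S := Vclass (idem_map Minf_map (repr u)).

Lemma V_mapE (a : idem (Minf R)) : V_map (Vclass a) = Vclass (idem_map Minf_map a).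
Proof. by apply/VclassP; apply: (mvn_map Minf_map); apply: mvn_repr. Qed.

Lemma V_map_is_nmod_morphism : nmod_morphism V_map.
Proof.
split=> [|u v].
  rewrite [0 in LHS]/(Vclass (idem0 _)) V_mapE.
  by congr Vclass; apply: val_inj; rewrite /= raddf0.
rewrite -(VreprP u) -(VreprP v).
rewrite -(Vclass_spread Even (repr u)) -(Vclass_spread Odd (repr v)).
rewrite V_addE /= ?spread_orth// => uv vu; rewrite !V_mapE V_addE.
- by rewrite /= -rmorphMg uv raddf0.
- by rewrite /= -rmorphMg vu raddf0.
by move=> *; congr Vclass; apply: val_inj; rewrite /= raddfD.
Qed.

HB.instance Definition _ :=
  GRing.isNmodMorphism.Build (V R) (V S) V_map V_map_is_nmod_morphism.

End VFunctor.

Lemma V_map_id (R : rngType) (f : {rngmorphism R -> R}) :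
  f =1 id -> V_map f =1 id.
Proof.
move=> fid u; rewrite -(VreprP u) V_mapE; congr Vclass.
by apply/val_inj/MinfP => i j; rewrite /= fid.
Qed.

Lemma V_map_comp (R S T : rngType) (g : {rngmorphism S -> T})
    (f : {rngmorphism R -> S}) (h : {rngmorphism R -> T}) :
  h =1 g \o f -> V_map h =1 V_map g \o V_map f.
Proof.
move=> hgf u; rewrite -(VreprP u) /= !V_mapE; congr Vclass.
by apply/val_inj/MinfP => i j; rewrite /= hgf.
Qed.

HB.mixin Record isCStarAlgebra (R : realType) A
    & CompleteNormedModule R[i] A & Rng A := {
  star : A -> A;
  starK : forall x, star (star x) = x;
  starD : forall x y, star (x + y) = star x + star y;
  starZ : forall (k : R[i]) x, star (k *: x) = k^* *: star x;
  starM : forall x y : A, star (x ** y) = star y ** star x;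
  cscalerAl : forall (k : R[i]) (x y : A), k *: (x ** y) = (k *: x) ** y;
  cscalerAr : forall (k : R[i]) (x y : A), k *: (x ** y) = x ** (k *: y);
  cnormM : forall x y : A, `|x ** y| <= `|x| * `|y| :> R[i];
  cnorm_star : forall x : A, `|star x ** x| = `|x| ^+ 2 :> R[i]
}.

#[short(type="cstarAlgType")]
HB.structure Definition CStarAlgebra (R : realType) :=
  {A of CompleteNormedModule R[i] A & Rng A & isCStarAlgebra R A}.

HB.mixin Record isStarMorphism (R : realType) (A B : cstarAlgType R)
    (f : A -> B) := {
  star_morph : forall x, f (star x) = star (f x)
}.

HB.structure Definition CStarMorphism (R : realType) (A B : cstarAlgType R) :=
  {f of @GRing.Linear R[i] A B *:%R f & @Multiplicative A B f
      & @isStarMorphism R A B f}.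

Notation "{ 'cstarmorphism' A -> B }" := (CStarMorphism.type A%type B%type)
  (at level 0, A at level 98, format "{ 'cstarmorphism'  A  ->  B }") : type_scope.

Section Unitization.
Variables (R : realType) (A : cstarAlgType R).

Definition unitization : Type := A * R[i].

HB.instance Definition _ := GRing.Zmodule.on unitization.

Definition uz_mul (x y : unitization) : unitization :=
  (x.1 ** y.1 + x.2 *: y.1 + y.2 *: x.1, x.2 * y.2).

Lemma uz_mulA : associative uz_mul.
Proof.
move=> [x k] [y l] [z m]; rewrite /uz_mul/=; congr pair; last by rewrite mulrA.
rewrite !(rmulDl, rmulDr, scalerDr) !rmulA !scalerA -!(cscalerAl, cscalerAr).
rewrite [m * k]mulrC [m * l]mulrC -!addrA; congr (_ + _).
rewrite [RHS]addrCA; congr (_ + _); rewrite addrCA; congr (_ + _).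
by rewrite addrCA.
Qed.

HB.instance Definition _ := isSemigroup.Build unitization uz_mulA.

Lemma uz_mulDl (x y z : unitization) : uz_mul (x + y) z = uz_mul x z + uz_mul y z.
Proof.
rewrite /uz_mul; congr pair; last by rewrite mulrDl.
rewrite /= rmulDl scalerDl scalerDr.
by rewrite [RHS]addrACA [X in _ = X + _]addrACA.
Qed.

Lemma uz_mulDr (x y z : unitization) : uz_mul x (y + z) = uz_mul x y + uz_mul x z.
Proof.
rewrite /uz_mul; congr pair; last by rewrite mulrDr.
rewrite /= rmulDr scalerDl scalerDr.
by rewrite [RHS]addrACA [X in _ = X + _]addrACA.
Qed.

HB.instance Definition _ :=
  Zmodule_Semigroup_isRng.Build unitization uz_mulDl uz_mulDr.

Definition uz_star (x : unitization) : unitization := (star x.1, x.2^*).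

(* The operator norm of left multiplication by x on A, which is the C*-norm of
   the unitization when A has no unit. *)
Definition uz_norm (x : unitization) : R :=
  sup [set complex.Re `|x.1 ** c + x.2 *: c| | c in [set c : A | `|c| <= 1]].

End Unitization.

Definition invertible_selfadjoint_dense (R : realType) (A : rngType)
    (st : A -> A) (norm : A -> R) : Prop :=
  exists e : A, is_rng_unit e /\
  forall a : A, st a = a -> forall eps : R, 0 < eps ->
  exists b : A, [/\ st b = b, exists c : A, b ** c = e /\ c ** b = e
                  & norm (a - b) < eps].

(* Brown and Pedersen's definition: a C*-algebra without unit has real rank zero
   when its unitization does. *)
Definition real_rank_zero (R : realType) (A : cstarAlgType R) : Prop :=
  if `[< exists e : A, is_rng_unit e >] then
    @invertible_selfadjoint_dense R A (@star R A) (fun x => complex.Re `|x|)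
  else
    @invertible_selfadjoint_dense R (unitization A) (@uz_star R A) (@uz_norm R A).

Section Diagrams.
Context {d : Order.disp_t} (I : porderType d).

Record mon_diagram := MonDiagram {
  mon_obj :> I -> nmodType;
  mon_arr : forall p q : I, (p <= q)%O -> {additive mon_obj p -> mon_obj q};
  mon_arr_id : forall (p : I) (pp : (p <= p)%O) x, mon_arr pp x = x;
  mon_arr_comp : forall (p q r : I) (pq : (p <= q)%O) (qr : (q <= r)%O)
    (pr : (p <= r)%O) x, mon_arr pr x = mon_arr qr (mon_arr pq x)
}.

Record rng_diagram := RngDiagram {
  rng_obj :> I -> rngType;
  rng_arr : forall p q : I, (p <= q)%O -> {rngmorphism rng_obj p -> rng_obj q};
  rng_arr_id : forall (p : I) (pp : (p <= p)%O) x, rng_arr pp x = x;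
  rng_arr_comp : forall (p q r : I) (pq : (p <= q)%O) (qr : (q <= r)%O)
    (pr : (p <= r)%O) x, rng_arr pr x = rng_arr qr (rng_arr pq x)
}.

Record cstar_diagram (R : realType) := CStarDiagram {
  cstar_obj :> I -> cstarAlgType R;
  cstar_arr : forall p q : I, (p <= q)%O ->
    {cstarmorphism cstar_obj p -> cstar_obj q};
  cstar_arr_id : forall (p : I) (pp : (p <= p)%O) x, cstar_arr pp x = x;
  cstar_arr_comp : forall (p q r : I) (pq : (p <= q)%O) (qr : (q <= r)%O)
    (pr : (p <= r)%O) x, cstar_arr pr x = cstar_arr qr (cstar_arr pq x)
}.

Definition rng_diagram_of_cstar (R : realType) (X : cstar_diagram R) : rng_diagram :=
  @RngDiagram (fun p => X p) (fun p q pq => cstar_arr X pq)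
    (@cstar_arr_id R X) (@cstar_arr_comp R X).

Definition V_diagram (X : rng_diagram) : mon_diagram :=
  @MonDiagram (fun p => V (X p)) (fun p q pq => V_map (rng_arr X pq))
    (fun p pp => V_map_id (@rng_arr_id X p pp))
    (fun p q r pq qr pr => V_map_comp (@rng_arr_comp X p q r pq qr pr)).

Definition naturally_isomorphic (D E : mon_diagram) : Prop :=
  exists phi : forall p : I, {additive D p -> E p},
    (forall p, bijective (phi p)) /\
    (forall (p q : I) (pq : (p <= q)%O) x,
       phi q (mon_arr D pq x) = mon_arr E pq (phi p x)).

Definition lifts_wrt_V (X : rng_diagram) (D : mon_diagram) : Prop :=
  naturally_isomorphic (V_diagram X) D.

End Diagrams.

Definition cube : Type := bool *p bool *p bool.

HB.instance Definition _ := Order.POrder.on cube.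

Variant vertex := vA | vAj of 'I_3 | vBj of 'I_3 | vB.

Definition i0 : 'I_3 := @Ordinal 3 0 isT.
Definition i1 : 'I_3 := @Ordinal 3 1 isT.
Definition i2 : 'I_3 := @Ordinal 3 2 isT.

(* A_j is the atom {j} and B_j is the coatom opposite to it. *)
Definition vertex_of (p : cube) : vertex :=
  match p with
  | (false, false, false) => vA
  | (true, false, false) => vAj i0
  | (false, true, false) => vAj i1
  | (false, false, true) => vAj i2
  | (false, true, true) => vBj i0
  | (true, false, true) => vBj i1
  | (true, true, false) => vBj i2
  | (true, true, true) => vB
  end.

Definition e_map (x : nat) : nat * nat := (x, x).
Definition s_map (x : nat * nat) : nat * nat := (x.2, x.1).
Definition h_map (x : nat * nat) : nat := (x.1 + x.2)%N.

Lemma e_map_is_nmod_morphism : nmod_morphism e_map. Proof. by []. Qed.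
Lemma s_map_is_nmod_morphism : nmod_morphism s_map. Proof. by []. Qed.
Lemma h_map_is_nmod_morphism : nmod_morphism h_map.
Proof. by split=> // [[a b] [c d]]; rewrite /h_map /= addnACA. Qed.

HB.instance Definition _ :=
  GRing.isNmodMorphism.Build nat (nat * nat)%type e_map e_map_is_nmod_morphism.
HB.instance Definition _ :=
  GRing.isNmodMorphism.Build (nat * nat)%type (nat * nat)%type s_map
    s_map_is_nmod_morphism.
HB.instance Definition _ :=
  GRing.isNmodMorphism.Build (nat * nat)%type nat h_map h_map_is_nmod_morphism.

Definition D_obj (v : vertex) : nmodType :=
  match v with
  | vA | vB => nat
  | vAj _ | vBj _ => (nat * nat)%type
  end.

(* The composites A -> B_k, A_j -> B and A -> B do not depend on the path, since
   s \o e = e and h \o s = h.  Pairs (u, v) that are not comparable in the cube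
   get a dummy value, which [cube_diagram] never uses. *)
Definition D_arr (u v : vertex) : D_obj u -> D_obj v :=
  match u, v with
  | vA, vA => idfun
  | vA, vAj _ => e_map
  | vA, vBj _ => e_map
  | vA, vB => h_map \o e_map
  | vAj _, vAj _ => idfun
  | vAj j, vBj k => if (j == i1) && (k == i2) then s_map else idfun
  | vAj _, vB => h_map
  | vBj _, vBj _ => idfun
  | vBj _, vB => h_map
  | vB, vB => idfun
  | _, _ => fun=> 0
  end.

Lemma D_arr_is_nmod_morphism (u v : vertex) : nmod_morphism (@D_arr u v).
Proof.
by case: u v => [|j|j|] [|k|k|] /=; do ?case: ifP => _; split=> // x y;
  rewrite /= ?addr0 ?raddfD.
Qed.

HB.instance Definition _ (u v : vertex) :=
  GRing.isNmodMorphism.Build (D_obj u) (D_obj v) (@D_arr u v)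
    (D_arr_is_nmod_morphism u v).

Lemma D_arr_id (p : cube) (pp : (p <= p)%O) x :
  @D_arr (vertex_of p) (vertex_of p) x = x.
Proof. by case: p pp x => [[[] []] []]. Qed.

Lemma D_arr_comp (p q r : cube) (pq : (p <= q)%O) (qr : (q <= r)%O)
    (pr : (p <= r)%O) x :
  @D_arr (vertex_of p) (vertex_of r) x =
  @D_arr (vertex_of q) (vertex_of r) (@D_arr (vertex_of p) (vertex_of q) x).
Proof.
case: p q r pq qr pr x => [[[] []] []] [[[] []] []] [[[] []] []] //= _ _ _ x;
  by rewrite /h_map /= 1?addnC.
Qed.

Definition cube_diagram : mon_diagram cube :=
  @MonDiagram _ cube (fun p => D_obj (vertex_of p))
    (fun p q _ => @D_arr (vertex_of p) (vertex_of q)) D_arr_id D_arr_comp.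

(* Main.v *)
Require Import Defs.
From HB Require Import structures.
From mathcomp Require Import all_boot all_order all_algebra.
From mathcomp Require Import all_classical all_reals all_analysis.
From mathcomp Require Import complex zify ring lra.

(* Both classes of rings have the property that every nonzero x has a nonzero
   idempotent multiple x y.  Under this property, if p and q are idempotent
   matrices whose classes in V have no common nonzero lower bound, then pq = 0:
   a nonzero entry of pq would give a nonzero idempotent equivalent to idempotents
   below p and below q.  Hence, when V(R) = N^2, an idempotent e of class (1,1)
   has at most one decomposition e = p + q with p, q of classes (1,0), (0,1).

   In a lifting, let e have class 1 over A, and split its image in A_j as
   p_j + q_j.  Uniqueness in B_2, B_1 and B_0 gives p_0 = q_1, p_0 = p_2 and
   p_1 = p_2 over B, so p_1 = q_1 = 0 there, although p_1 has class 1.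

   For real rank zero, normalize h = x x^* and let b be an invertible self-adjoint
   element near h^2 - 1/2, and p its positive spectral projection (1 + sign b)/2.
   Then p is nonzero and p h^2 p is invertible in the corner pAp, with inverse g,
   say, and h^2 g is a nonzero idempotent.  The only functional calculus used is
   the square root of 1 - r for |r| < 1, obtained as a fixed point. *)

Set Implicit Arguments.
Unset Strict Implicit.
Unset Printing Implicit Defensive.

Import Order.TTheory GRing.Theory Num.Theory.
Import numFieldNormedType.Exports.

Local Open Scope complex_scope.
Local Open Scope ring_scope.

(** * Idempotent matrices and the diagram D *)

Definition has_idempotent_multiples (R : rngType) : Prop :=
  forall x : R, x <> 0 ->
  exists y : R, (x ** y) ** (x ** y) = x ** y /\ x ** y <> 0.

Lemma regular_has_idempotent_multiples (R : rngType) :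
  regular_rng R -> has_idempotent_multiples R.
Proof.
move=> regR x x0; have [y xyx] := regR x; exists y; split; first by rewrite rmulA xyx.
by move=> xy0; apply: x0; rewrite -xyx xy0 rmul0l.
Qed.

Section Idempotents.
Variable R : rngType.
Implicit Types (e p q : idem (Minf R)) (u v : V R).

(** If [p = x y] and [y x = 0], then [p = p p = x (y x) y = 0]. *)
Lemma Vclass_eq0 p : Vclass p = 0 -> ival p = 0.
Proof.
move=> /VclassP[x [y [pxy yx0]]].
by rewrite -idemE pxy rmulA -(rmulA x) -yx0 rmul0r rmul0l.
Qed.

Lemma Vclass_idem0 p : ival p = 0 -> Vclass p = 0.
Proof. by move=> p0; congr Vclass; apply: val_inj. Qed.

(* If e = x y is equivalent to y x = a + b, where a and b are orthogonal of
   classes u and v, then e is the sum of x a y and x b y. *)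
Lemma Vclass_split e u v : Vclass e = u + v ->
  exists p q, [/\ Vclass p = u, Vclass q = v, ival e = ival p + ival q,
    ival p ** ival q = 0 & ival q ** ival p = 0].
Proof.
rewrite -(VreprP u) -(VreprP v).
rewrite -(Vclass_spread Even (repr u)) -(Vclass_spread Odd (repr v)).
set a := spread_idem _ _; set b := spread_idem _ _.
have ab : ival a ** ival b = 0 by rewrite spread_orth.
have ba : ival b ** ival a = 0 by rewrite spread_orth.
rewrite (V_addE ab ba) => /VclassP; clearbody a b.
move=> /mvn_normalize-/(_ (idemE _) (idemE _))[x [y [exy /= abyx _ _]]].
have key (c d : idem (Minf R)) : x ** ival c ** y ** (x ** ival d ** y) =
    x ** (ival c ** (ival a + ival b) ** ival d) ** y.
  by rewrite abyx !rmulA.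
have pP : (x ** ival a ** y) ** (x ** ival a ** y) == x ** ival a ** y.
  by rewrite key rmulDr (idemE a) ab addr0 (idemE a).
have qP : (x ** ival b ** y) ** (x ** ival b ** y) == x ** ival b ** y.
  by rewrite key rmulDr (idemE b) ba add0r (idemE b).
exists (MkIdem pP), (MkIdem qP); split => /=.
- apply/VclassP; exists (x ** ival a), (ival a ** y); split=> /=.
    by rewrite rmulA -(rmulA x (ival a) (ival a)) idemE.
  by rewrite rmulA -(rmulA (ival a)) -abyx rmulDr (idemE a) ab addr0 (idemE a).
- apply/VclassP; exists (x ** ival b), (ival b ** y); split=> /=.
    by rewrite rmulA -(rmulA x (ival b) (ival b)) idemE.
  by rewrite rmulA -(rmulA (ival b)) -abyx rmulDr (idemE b) ba add0r (idemE b).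
- by rewrite -rmulDl -rmulDr abyx rmulA -exy -rmulA -exy (idemE e).
- by rewrite key rmulDr (idemE a) ab addr0 ab rmul0r rmul0l.
- by rewrite key rmulDr (idemE b) ba add0r ba rmul0r rmul0l.
Qed.

(** A factorization of [f] through [p] makes [y x] an idempotent below [p] and equivalent to [f];
    the complement [c = p - y x] supplies the class [v]. *)
Lemma Vclass_le p f x y : ival f = x ** y -> ival f ** x = x ->
  x ** ival p = x -> ival p ** y = y -> exists v, Vclass p = Vclass f + v.
Proof.
move=> fxy fx xp py.
have gP : (y ** x) ** (y ** x) == y ** x by rewrite rmulA -(rmulA y) -fxy -rmulA fx.
have pg : ival p ** (y ** x) = y ** x by rewrite rmulA py.
have gp : (y ** x) ** ival p = y ** x by rewrite -rmulA xp.
pose g := MkIdem gP; pose c := ival p - y ** x.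
have cg : c ** (y ** x) = 0.
  by apply: (addIr (y ** x)); rewrite -{2}(eqP gP) -rmulDl subrK pg add0r.
have gc : (y ** x) ** c = 0.
  by apply: (addIr (y ** x)); rewrite -{2}(eqP gP) -rmulDr subrK gp add0r.
have cp : c ** ival p = c.
  by apply: (addIr (y ** x)); rewrite -{1}gp -rmulDl subrK idemE.
have pE : ival p = y ** x + c by rewrite addrC subrK.
have cP : c ** c == c.
  by rewrite -{3}cp; move: cp; rewrite pE; clearbody c; rewrite rmulDr cg add0r.
exists (Vclass (MkIdem cP)).
have -> : Vclass f = Vclass g by apply/VclassP; exists x, y.
by rewrite V_addE; congr Vclass; apply: val_inj; rewrite /= pE.
Qed.

Hypothesis richR : has_idempotent_multiples R.

Definition single (i j : nat) (r : R) : nat -> nat -> R :=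
  fun k l => if (k == i) && (l == j) then r else 0.

Lemma single_finite i j r : single i j r \in @finite_mx R.
Proof.
apply/asboolP; exists (maxn i j).+1 => k l kl; rewrite /single.
by case: ifP => // /andP[/eqP ki /eqP lj]; lia.
Qed.

Definition single_mx i j r : Minf R := MkMinf (single_finite i j r).

Lemma single_mxM i j k r s : single_mx i j r ** single_mx j k s = single_mx i k (r ** s).
Proof.
have [n En] := mulM_bound (single_mx i j r).
apply: MinfP => l m; rewrite MinfME (En (maxn n j.+1) (leq_maxl _ _)).1.
have jn : (j < maxn n j.+1)%N by rewrite leq_max ltnSn orbT.
rewrite (bigD1 (Ordinal jn)) //= big1 => [|o /eqP oj]; last first.
  rewrite /single; case: (@eqP _ (o : nat)) => [E|]; first by case: oj; apply: val_inj.
  by rewrite !andbF rmul0l.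
rewrite /single !eqxx !andbT addr0.
by case: (l == i); case: (m == k); rewrite ?rmul0l ?rmul0r.
Qed.

(** Only the summands of indices [j] and [k] survive. Such products cut one entry out of [a] and so
    pass from matrices to [R], where [richR] applies. *)
Lemma single_mx_sandwich i j k l r s (a : Minf R) :
  single_mx i j r ** a ** single_mx k l s = single_mx i l (r ** a j k ** s).
Proof.
have [n En] := mulM_bound (single_mx i j r).
have [m Em] := mulM_bound (single_mx k l s).
apply: MinfP => u v; rewrite MinfME (Em (maxn m k.+1) (leq_maxl _ _)).2.
have jn : (j < maxn n j.+1)%N by rewrite leq_max ltnSn orbT.
have km : (k < maxn m k.+1)%N by rewrite leq_max ltnSn orbT.
rewrite (bigD1 (Ordinal km)) //= big1 => [|o /eqP oj]; last first.
  rewrite /single; case: (@eqP _ (o : nat)) => [E|]; first by case: oj; apply: val_inj.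
  by rewrite rmul0r.
rewrite -[mulM_fun _ _ _ _]/(mulM (single_mx i j r) a u k).
rewrite (En (maxn n j.+1) (leq_maxl _ _)).1.
rewrite (bigD1 (Ordinal jn)) //= big1 => [|o /eqP oj]; last first.
  rewrite /single; case: (@eqP _ (o : nat)) => [E|]; first by case: oj; apply: val_inj.
  by rewrite andbF rmul0l.
rewrite /single !eqxx !andbT !addr0.
by case: (u == i); case: (v == l); rewrite ?rmul0l ?rmul0r.
Qed.

(* If an entry x of pq is nonzero and h = xy is an idempotent, the matrix with
   single entry h is equivalent to idempotents below both p and q. *)
Lemma idem_orthogonal p q :
  (forall u v w, Vclass p = u + v -> Vclass q = u + w -> u = 0) ->
  ival p ** ival q = 0.
Proof.
move=> disj; apply: MinfP => i j; apply: contrapT => x0.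
have [y [hh h0]] := richR x0.
set x := (ival p ** ival q) i j in x0 hh h0 *.
set h := x ** y in hh h0.
have fP : single_mx i i h ** single_mx i i h == single_mx i i h.
  by rewrite single_mxM hh.
pose f := MkIdem fP; pose w := single_mx j i (y ** h).
(* The entry at [(i, i)] is [h x (y h)], and [x y = h] is idempotent. *)
have fpqw : ival f = ival f ** ival p ** ival q ** w.
  by rewrite -(rmulA (ival f)) single_mx_sandwich -/x rmulA -(rmulA h) hh hh.
have ff := idemE f.
(* Bracketing the product as [(f p) (p q w)] puts a copy of [f] below [p]; bracketing it as
   [(f p q) (q w)] then puts one below [q]. *)
have [v pE] : exists v, Vclass p = Vclass f + v.
  apply: (@Vclass_le p f (ival f ** ival p) (ival p ** ival q ** w)).
  - by rewrite {1}fpqw !rmulA -(rmulA _ (ival p) (ival p)) idemE.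
  - by rewrite rmulA ff.
  - by rewrite -rmulA idemE.
  - by rewrite !rmulA idemE.
have [v' qE] : exists v, Vclass q = Vclass f + v.
  apply: (@Vclass_le q f (ival f ** ival p ** ival q) (ival q ** w)).
  - by rewrite {1}fpqw !rmulA -(rmulA _ (ival q) (ival q)) idemE.
  - by rewrite !rmulA ff.
  - by rewrite -(rmulA _ (ival q)) (idemE q).
  - by rewrite !rmulA idemE.
have /Vclass_eq0/(congr1 (fun a : Minf R => a i i)) := disj _ _ _ pE qE.
by rewrite /= /single eqxx.
Qed.

End Idempotents.

(** * Idempotents of a ring whose monoid V is N^2 *)

Section Basis.
Variables (R : rngType) (psi : {additive V R -> (nat * nat)%type}).
Hypothesis psi_bij : bijective psi.

(** The sum [(1, 0) + (0, 1)] is pulled back along [psi] and realized inside [e] itself by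
    [Vclass_split]. *)
Lemma basis_split (e : idem (Minf R)) : psi (Vclass e) = (1, 1)%N ->
  exists p q, [/\ psi (Vclass p) = (1, 0)%N, psi (Vclass q) = (0, 1)%N,
    ival e = ival p + ival q & ival p ** ival q = 0].
Proof.
move=> e1; have [g gK Kg] := psi_bij.
have : Vclass e = g (1, 0)%N + g (0, 1)%N.
  by apply: (can_inj gK); rewrite raddfD /= !Kg e1.
move=> /Vclass_split[p [q [pE qE epq pq _]]].
by exists p, q; rewrite pE qE !Kg.
Qed.

Hypothesis richR : has_idempotent_multiples R.

(** An element of N^2 below both [(1, 0)] and [(0, 1)] is zero, so [idem_orthogonal] applies in
    either order. *)
Lemma basis_idem_orthogonal (p q : idem (Minf R)) :
  psi (Vclass p) = (1, 0)%N -> psi (Vclass q) = (0, 1)%N ->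
  ival p ** ival q = 0 /\ ival q ** ival p = 0.
Proof.
move=> p1 q1; have psi0 u : psi u = (0, 0)%N -> u = 0.
  by move=> u0; apply: (bij_inj psi_bij); rewrite u0 raddf0.
have zero a b c d : (1, 0)%N = (a, b) + (c, d) :> nat * nat ->
    forall e f, (0, 1)%N = (a, b) + (e, f) :> nat * nat -> (a, b) = (0, 0)%N.
  by move=> [? ?] e f [? ?]; congr pair; lia.
split; apply: (idem_orthogonal richR) => u v w /(congr1 psi) + /(congr1 psi);
  rewrite p1 q1 !raddfD => pE qE; apply: psi0.
  by move: pE qE; case: (psi u) (psi v) (psi w) => [a b] [c d] [e f] /zero/[apply].
by move: qE pE; case: (psi u) (psi v) (psi w) => [a b] [c d] [e f] /zero/[apply].
Qed.

(** By orthogonality [p = p (p + q) = p (p' + q') = p p'], and likewise [p' = (p + q) p' = p p']. *)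
Lemma basis_decomposition_unique (p q p' q' : idem (Minf R)) :
  psi (Vclass p) = (1, 0)%N -> psi (Vclass q) = (0, 1)%N ->
  psi (Vclass p') = (1, 0)%N -> psi (Vclass q') = (0, 1)%N ->
  ival p + ival q = ival p' + ival q' -> ival p = ival p'.
Proof.
move=> p1 q1 p'1 q'1 E.
have [pq' _] := basis_idem_orthogonal p1 q'1.
have [_ qp'] := basis_idem_orthogonal p'1 q1.
have [pq _] := basis_idem_orthogonal p1 q1.
have [p'q' q'p'] := basis_idem_orthogonal p'1 q'1.
have : ival p ** (ival p + ival q) = ival p ** (ival p' + ival q') by rewrite E.
rewrite !rmulDr pq pq' !addr0 idemE => ->.
have : (ival p + ival q) ** ival p' = (ival p' + ival q') ** ival p' by rewrite E.
by rewrite !rmulDl qp' q'p' !addr0 idemE.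
Qed.

End Basis.

(** * Chasing idempotents around the cube *)

Lemma cube_diagram_no_lift (X : rng_diagram cube) :
  (forall p, has_idempotent_multiples (X p)) -> ~ lifts_wrt_V X cube_diagram.
Proof.
move=> richX [phi [phi_bij phi_nat]].
pose vtx (a b c : bool) : cube := (a, b, c).
pose A := vtx false false false.
pose A0 := vtx true false false; pose A1 := vtx false true false.
pose A2 := vtx false false true; pose B0 := vtx false true true.
pose B1 := vtx true false true; pose B2 := vtx true true false.
pose B := vtx true true true.
pose img (p q : cube) (pq : (p <= q)%O) (a : idem (Minf (X p))) :=
  idem_map (Minf_map (rng_arr X pq)) a.
have imgV p q (pq : (p <= q)%O) a :
    phi q (Vclass (img p q pq a)) = mon_arr cube_diagram pq (phi p (Vclass a)).
  by rewrite -phi_nat /= V_mapE.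
have imgD p q (pq : (p <= q)%O) a b c : ival a = ival b + ival c ->
    ival (img p q pq a) = ival (img p q pq b) + ival (img p q pq c).
  by move=> E; rewrite /= E raddfD.
(* Commutativity of the lifting diagram gives equality of the matrices themselves, not only of their
   classes. *)
have imgC p q r (pq : (p <= q)%O) (qr : (q <= r)%O) (pr : (p <= r)%O) a :
    ival (img p r pr a) = ival (img q r qr (img p q pq a)).
  by apply: MinfP => i j; rewrite /= (rng_arr_comp pq qr).
have imgI p q (pq : (p <= q)%O) a b : ival a = ival b ->
    ival (img p q pq a) = ival (img p q pq b) by move=> E; rewrite /= E.
have [e eE] : exists e, phi A (Vclass e) = 1%N.
  by have [g _ Kg] := phi_bij A; exists (repr (g 1%N)); rewrite VreprP Kg.
have [AA0 AA1 AA2] : [/\ (A <= A0)%O, (A <= A1)%O & (A <= A2)%O] by [].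
have [A0B1 A0B2 A1B0] : [/\ (A0 <= B1)%O, (A0 <= B2)%O & (A1 <= B0)%O] by [].
have [A1B2 A2B0 A2B1] : [/\ (A1 <= B2)%O, (A2 <= B0)%O & (A2 <= B1)%O] by [].
have [B0B B1B B2B] : [/\ (B0 <= B)%O, (B1 <= B)%O & (B2 <= B)%O] by [].
have [A0B A1B A2B] : [/\ (A0 <= B)%O, (A1 <= B)%O & (A2 <= B)%O] by [].
have [AB0 AB1 AB2] : [/\ (A <= B0)%O, (A <= B1)%O & (A <= B2)%O] by [].
have [p0 [q0 [p0E q0E e0E _]]] : exists p q,
    [/\ phi A0 (Vclass p) = (1, 0)%N, phi A0 (Vclass q) = (0, 1)%N,
    ival (img A A0 AA0 e) = ival p + ival q & ival p ** ival q = 0].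
  by apply: (basis_split (phi_bij A0)); rewrite imgV eE.
have [p1 [q1 [p1E q1E e1E pq1]]] : exists p q,
    [/\ phi A1 (Vclass p) = (1, 0)%N, phi A1 (Vclass q) = (0, 1)%N,
    ival (img A A1 AA1 e) = ival p + ival q & ival p ** ival q = 0].
  by apply: (basis_split (phi_bij A1)); rewrite imgV eE.
have [p2 [q2 [p2E q2E e2E _]]] : exists p q,
    [/\ phi A2 (Vclass p) = (1, 0)%N, phi A2 (Vclass q) = (0, 1)%N,
    ival (img A A2 AA2 e) = ival p + ival q & ival p ** ival q = 0].
  by apply: (basis_split (phi_bij A2)); rewrite imgV eE.
(* The arrow from [A1] to [B2] is the swap, so in [B2] it is [q1] that has class [(1, 0)] and is
   matched with [p0]. *)
have p0q1 : ival (img A0 B2 A0B2 p0) = ival (img A1 B2 A1B2 q1).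
  apply: (@basis_decomposition_unique _ _ (phi_bij B2) (richX B2)
    _ (img A0 B2 A0B2 q0) _ (img A1 B2 A1B2 p1)).
  - by rewrite imgV p0E.
  - by rewrite imgV q0E.
  - by rewrite imgV q1E.
  - by rewrite imgV p1E.
  - rewrite -(imgD _ _ A0B2 _ _ _ e0E) addrC -(imgD _ _ A1B2 _ _ _ e1E).
    by rewrite -!(imgC _ _ _ _ _ AB2).
have p0p2 : ival (img A0 B1 A0B1 p0) = ival (img A2 B1 A2B1 p2).
  apply: (@basis_decomposition_unique _ _ (phi_bij B1) (richX B1)
    _ (img A0 B1 A0B1 q0) _ (img A2 B1 A2B1 q2)).
  - by rewrite imgV p0E.
  - by rewrite imgV q0E.
  - by rewrite imgV p2E.
  - by rewrite imgV q2E.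
  - rewrite -(imgD _ _ A0B1 _ _ _ e0E) -(imgD _ _ A2B1 _ _ _ e2E).
    by rewrite -!(imgC _ _ _ _ _ AB1).
have p1p2 : ival (img A1 B0 A1B0 p1) = ival (img A2 B0 A2B0 p2).
  apply: (@basis_decomposition_unique _ _ (phi_bij B0) (richX B0)
    _ (img A1 B0 A1B0 q1) _ (img A2 B0 A2B0 q2)).
  - by rewrite imgV p1E.
  - by rewrite imgV q1E.
  - by rewrite imgV p2E.
  - by rewrite imgV q2E.
  - rewrite -(imgD _ _ A1B0 _ _ _ e1E) -(imgD _ _ A2B0 _ _ _ e2E).
    by rewrite -!(imgC _ _ _ _ _ AB0).
(* Over [B] the chain is [p1 = p2] through [B0], [p2 = p0] through [B1] and [p0 = q1] through
   [B2]. *)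
have E : ival (img A1 B A1B p1) = ival (img A1 B A1B q1).
  rewrite (imgC _ _ _ A1B0 B0B A1B) (imgI _ _ _ _ _ p1p2) -(imgC _ _ _ A2B0 B0B A2B).
  rewrite (imgC _ _ _ A2B1 B1B A2B) -(imgI _ _ _ _ _ p0p2) -(imgC _ _ _ A0B1 B1B A0B).
  by rewrite (imgC _ _ _ A0B2 B2B A0B) (imgI _ _ _ _ _ p0q1) -(imgC _ _ _ A1B2 B2B A1B).
(* Over [B] this forces [p1 = p1 p1 = p1 q1 = 0], whereas its class is [h (1, 0) = 1]. *)
have P0 : ival (img A1 B A1B p1) = 0.
  by rewrite -idemE {2}E /= -rmorphMg pq1 raddf0.
have := imgV _ _ A1B p1; rewrite p1E (Vclass_idem0 P0) raddf0.
by [].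
Qed.

(** * Real rank zero in an abstract unital C*-algebra *)

(** The interface shared by a nonzero unital C*-algebra and by the unitization of a nonunital one.
    The norm is real-valued, and completeness is stated for geometric increments, the kind that
    contraction iterations produce. *)
Record unital_cstar (R : realType) (B : algType R[i]) (st : B -> B)
    (nrm : B -> R) : Prop := UnitalCStar {
  st_K : forall x, st (st x) = x;
  st_D : forall x y, st (x + y) = st x + st y;
  st_Z : forall (k : R[i]) x, st (k *: x) = k^* *: st x;
  st_M : forall x y, st (x * y) = st y * st x;
  nrm_D : forall x y, nrm (x + y) <= nrm x + nrm y;
  nrm_Z : forall (k : R[i]) x, nrm (k *: x) = complex.Re `|k| * nrm x;
  nrm_M : forall x y, nrm (x * y) <= nrm x * nrm y;
  nrm_st : forall x, nrm x ^+ 2 <= nrm (st x * x);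
  nrm_eq0 : forall x, nrm x = 0 -> x = 0;
  nrm_complete : forall (u : nat -> B) (C r : R), 0 <= r < 1 ->
    (forall n, nrm (u n.+1 - u n) <= C * r ^+ n) ->
    exists l, forall e, 0 < e ->
      exists N, forall n, (N <= n)%N -> nrm (u n - l) < e
}.

Section UnitalCStar.
Variables (R : realType) (B : algType R[i]) (st : B -> B) (nrm : B -> R).
Hypothesis BC : unital_cstar st nrm.
Implicit Types (x y z b c : B) (t : R).

Let stK := st_K BC.
Let stD := st_D BC.
Let stZ := st_Z BC.
Let stM := st_M BC.
Let nrmD := nrm_D BC.
Let nrmM := nrm_M BC.
Let nrm_eq0 := nrm_eq0 BC.

Lemma nrmZr t x : nrm (t%:C *: x) = `|t| * nrm x.
Proof. by rewrite (nrm_Z BC) normc_def /= expr0n addr0 sqrtr_sqr. Qed.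

Lemma nrm0 : nrm 0 = 0.
Proof. by rewrite -(scale0r (0 : B)) -[0 in LHS]/(0%:C : R[i]) nrmZr normr0 mul0r. Qed.

Lemma nrmN x : nrm (- x) = nrm x.
Proof.
have -> : - x = (-1)%:C *: x by rewrite raddfN /= scaleN1r.
by rewrite nrmZr normrN1 mul1r.
Qed.

Lemma nrm_ge0 x : 0 <= nrm x.
Proof. by have := nrmD x (- x); rewrite subrr nrm0 nrmN; lra. Qed.

Lemma nrmB x y : nrm (x - y) <= nrm x + nrm y.
Proof. by rewrite -(nrmN y) nrmD. Qed.

Lemma st0 : st 0 = 0.
Proof. by rewrite -(scale0r (0 : B)) stZ rmorph0 !scale0r. Qed.

Lemma stN x : st (- x) = - st x.
Proof. by apply: (addrI (st x)); rewrite -stD !subrr st0. Qed.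

Lemma stB x y : st (x - y) = st x - st y.
Proof. by rewrite stD stN. Qed.

Lemma st1 : st 1 = 1.
Proof. by rewrite -[RHS]stK -[st 1 in RHS]mul1r stM stK mul1r. Qed.

Lemma stZr t x : st (t%:C *: x) = t%:C *: st x.
Proof. by rewrite stZ -[_^*]/(conjc _) /= oppr0. Qed.

(** The axioms give [|y|^2 <= |star y| |y|]; after cancelling [|y|], the bound is used for both [x]
    and [star x]. *)
Lemma nrm_star x : nrm (st x) = nrm x.
Proof.
suff le y : nrm y <= nrm (st y) by apply/eqP; rewrite eq_le le -{2}(stK x) le.
have [->|y0] := eqVneq (nrm y) 0; first exact: nrm_ge0.
have {}y0 : 0 < nrm y by rewrite lt_def y0 nrm_ge0.
have := le_trans (nrm_st BC y) (nrmM _ _).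
by rewrite expr2 ler_pM2r.
Qed.

Lemma nrm_sa x : st x = x -> nrm (x * x) = nrm x ^+ 2.
Proof.
move=> xs; apply/eqP; rewrite eq_le nrmM /=.
by have := nrm_st BC x; rewrite xs.
Qed.

Lemma nrm_proj p : st p = p -> p * p = p -> nrm p <= 1.
Proof.
move=> ps pp; have := nrm_sa ps; rewrite pp => E.
have := nrm_ge0 p; nra.
Qed.

Lemma nrm1 : nrm 1 <= 1.
Proof. by apply: nrm_proj; rewrite ?st1 ?mulr1. Qed.

Lemma nrm_small x : (forall e, 0 < e -> nrm x < e) -> x = 0.
Proof.
move=> xe; apply: nrm_eq0; apply/eqP; rewrite eq_le nrm_ge0 andbT.
by apply/ler_addgt0Pr => e e0; rewrite add0r ltW ?xe.
Qed.

(** * Norm-closed conditions and the contraction principle *)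

Definition nrm_closed (P : B -> Prop) : Prop :=
  forall l, (forall e, 0 < e -> exists x, P x /\ nrm (x - l) < e) -> P l.

Lemma closed_and (P Q : B -> Prop) :
  nrm_closed P -> nrm_closed Q -> nrm_closed (fun x => P x /\ Q x).
Proof.
move=> cP cQ l H; split; [apply: cP|apply: cQ] => e e0;
  by have [x [[Px Qx] xe]] := H e e0; exists x.
Qed.

Lemma closed_sa : nrm_closed (fun x => st x = x).
Proof.
move=> l H; apply/eqP; rewrite -subr_eq0; apply/eqP/nrm_small => e e0.
have [x [xs xe]] := H (e / 2) ltac:(lra).
have -> : st l - l = (x - l) - st (x - l).
  by rewrite stB xs opprB [RHS]addrC addrA subrK.
have := nrmB (x - l) (st (x - l)); rewrite nrm_star; lra.
Qed.

Lemma closed_ball t : nrm_closed (fun x => nrm x <= t).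
Proof.
move=> l H; apply/ler_addgt0Pr => e e0.
have [x [xt xe]] := H e e0.
have := nrmB x (x - l); rewrite subKr; lra.
Qed.

Lemma closed_comm (Q : B -> Prop) :
  nrm_closed (fun x => forall y, Q y -> y * x = x * y).
Proof.
move=> l H y Qy; apply/eqP; rewrite -subr_eq0; apply/eqP/nrm_small => e e0.
(* The commutator of [y] and [l] is at most [2 |y| |x - l|]; the added 1 keeps the divisor
   positive. *)
have y1 : 0 < 2 * nrm y + 1 by have := nrm_ge0 y; lra.
have [x [xc xe]] := H (e / (2 * nrm y + 1)) ltac:(by rewrite divr_gt0).
have -> : y * l - l * y = (x - l) * y - y * (x - l).
  by rewrite mulrBl mulrBr (xc y Qy) opprB [RHS]addrC addrA subrK.
have := nrmB ((x - l) * y) (y * (x - l)).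
have := nrmM (x - l) y; have := nrmM y (x - l).
move: xe; rewrite ltr_pdivlMr//; have := nrm_ge0 (x - l); have := nrm_ge0 y.
move: (nrm _) (nrm _) (nrm _) (nrm _) => *; nra.
Qed.

(** Banach's fixed-point theorem, iterating from 0; the closed invariant [P] records what the fixed
    point inherits from the iterates. *)
Lemma fixpoint (P : B -> Prop) (F : B -> B) (r : R) :
  0 <= r < 1 -> P 0 -> (forall x, P x -> P (F x)) -> nrm_closed P ->
  (forall x y, P x -> P y -> nrm (F x - F y) <= r * nrm (x - y)) ->
  exists l, P l /\ F l = l.
Proof.
move=> r01 P0 PF cP lip; have /andP[r0 r1] := r01.
pose u n := iter n F 0; have Pu n : P (u n) by elim: n => //= n; exact: PF.
have [l lim] : exists l, forall e, 0 < e ->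
    exists N, forall n, (N <= n)%N -> nrm (u n - l) < e.
  apply: (nrm_complete BC (C := nrm (F 0)) r01); elim=> [|n IH].
    by rewrite /u /= subr0 expr0 mulr1.
  have := lip _ _ (Pu n.+1) (Pu n).
  rewrite -[F (u n.+1)]/(u n.+2) -[F (u n)]/(u n.+1) => /le_trans; apply.
  by rewrite exprS mulrCA ler_wpM2l.
have Pl : P l.
  by apply: cP => e /lim[N /(_ N (leqnn N)) lN]; exists (u N).
exists l; split => //; apply/eqP; rewrite -subr_eq0; apply/eqP/nrm_small => e e0.
have [N lN] := lim (e / 2) ltac:(lra).
have := lip _ _ (Pu N) Pl; have := lN N (leqnn N); have := lN N.+1 (leqnSn N).
have -> : F l - l = (u N.+1 - l) - (u N.+1 - F l).
  by rewrite opprB [RHS]addrC addrA subrK.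
have := nrmB (u N.+1 - l) (u N.+1 - F l); have := nrm_ge0 (u N - l).
rewrite -[F (u N)]/(u N.+1); nra.
Qed.

Lemma scale_half x : 2^-1%:C *: (x + x) = x.
Proof. by rewrite scalerDr -scalerDl -raddfD /= -[2^-1]div1r -splitr rmorph1 scale1r. Qed.

(** The inverse is the fixed point of [g |-> 1 + x g]. *)
Lemma neumann x : nrm x < 1 -> exists g, (1 - x) * g = 1.
Proof.
move=> x1.
have [|||||g [_ gE]] := @fixpoint (fun=> True) (fun g => 1 + x * g) (nrm x) => //.
- by rewrite nrm_ge0.
- by move=> y z _ _; rewrite opprD addrACA subrr add0r -mulrBr nrmM.
by exists g; rewrite mulrBl mul1r -{1}gE addrK.
Qed.

(* 1 - z with z the fixed point of z |-> (x + z^2) / 2, a contraction of the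
   ball of radius |x|. *)
Lemma sqrt_1B x : st x = x -> nrm x < 1 -> exists z,
  [/\ st z = z, nrm z <= nrm x, (1 - z) * (1 - z) = 1 - x &
      forall y, y * x = x * y -> y * z = z * y].
Proof.
move=> xs x1; have x0 := nrm_ge0 x.
pose P z := (st z = z /\ nrm z <= nrm x) /\ (forall y, y * x = x * y -> y * z = z * y).
have [|||||z [[[zs zx] zc] zE]] := @fixpoint P (fun z => 2^-1%:C *: (x + z * z)) (nrm x).
- by rewrite x0.
- by rewrite /P st0 nrm0; do !split=> //; move=> y _; rewrite mulr0 mul0r.
- move=> z [[zs zx] zc]; split; first split.
  + by rewrite stZr stD stM xs zs.
  + rewrite nrmZr gtr0_norm ?invr_gt0//.
    have := nrmD x (z * z); rewrite nrm_sa//; have := nrm_ge0 z; nra.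
  + move=> y yx; rewrite -scalerAr -scalerAl mulrDr mulrDl yx.
    by rewrite mulrA (zc y yx) -mulrA (zc y yx) mulrA.
- by apply: closed_and; [apply: closed_and; [exact: closed_sa|exact: closed_ball]
                        |exact: closed_comm].
- move=> z w [[zs zx] zc] [[ws wx] wc].
  rewrite -scalerBr opprD addrACA subrr add0r nrmZr gtr0_norm ?invr_gt0//.
  have -> : z * z - w * w = z * (z - w) + (z - w) * w.
    by rewrite mulrBr mulrBl addrA subrK.
  have := nrmD (z * (z - w)) ((z - w) * w).
  have := nrmM z (z - w); have := nrmM (z - w) w; have := nrm_ge0 (z - w).
  move: (nrm (z - w)) (nrm (z * _)) (nrm (_ * w)) (nrm (_ + _)) => *; nra.
exists z; split => //.
have zz : z + z = x + z * z by rewrite -{1 2}zE -scalerDr scale_half.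
by rewrite mulrBl mul1r mulrBr mulr1 -addrA -opprD addrA zz addrK.
Qed.

(* x + iy has norm sqrt |x^2 + y^2|, and x is its real part. *)
Lemma nrm_sq_le x y : st x = x -> st y = y -> x * y = y * x ->
  nrm x ^+ 2 <= nrm (x * x + y * y).
Proof.
move=> xs ys xy; pose v := x + 'i *: y.
have sv : st v = x - 'i *: y by rewrite stD stZ xs ys conjCi scaleNr.
have vv : st v * v = x * x + y * y.
  rewrite sv /v mulrBl !mulrDr -!scalerAl -!scalerAr xy.
  have ii : 'i * 'i = -1 :> R[i] by rewrite -expr2 sqrCi.
  by rewrite scalerA ii scaleN1r opprD opprK addrA addrK.
have xv : (2 : R)%:C *: x = v + st v.
  by rewrite sv addrACA subrr addr0 -[x in RHS]scale1r -scalerDl -raddfD.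
have := nrmD v (st v); rewrite -xv nrmZr nrm_star => xle.
have := nrm_st BC v; rewrite vv; apply: le_trans.
have := nrm_ge0 x; move: xle; rewrite gtr0_norm//; nra.
Qed.

(** If [s] is a self-adjoint square root of [1 - b^2] commuting with [b], then
    [|1 - b^2| = |s|^2 <= |s^2 + b^2| = |1|]. *)
Lemma nrm_1Bsq b : st b = b -> nrm b < 1 -> nrm (1 - b * b) <= 1.
Proof.
move=> bs b1; have b0 := nrm_ge0 b.
have rs : st (b * b) = b * b by rewrite stM bs.
have r1 : nrm (b * b) < 1 by rewrite nrm_sa//; nra.
have [z [zs _ zE zc]] := sqrt_1B rs r1.
have ss : st (1 - z) = 1 - z by rewrite stB st1 zs.
have sb : (1 - z) * b = b * (1 - z).
  by rewrite mulrBl mulrBr mul1r mulr1 zc// mulrA.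
rewrite -zE nrm_sa//; apply: le_trans (nrm_sq_le ss bs sb) _.
by rewrite zE subrK nrm1.
Qed.

Lemma inv_sa b c : st b = b -> b * c = 1 -> c * b = 1 -> st c = c.
Proof.
move=> bs bc cb; have scb : st c * b = 1 by rewrite -{1}bs -stM bc st1.
by rewrite -[LHS]mulr1 -bc mulrA scb mul1r.
Qed.

(* b^2 - delta is the square of a self-adjoint element for small delta > 0. *)
Lemma nrm_1B_sq_lt b c : st b = b -> b * c = 1 -> c * b = 1 ->
  exists2 t, 0 < t & nrm (1 - t%:C *: (b * b)) < 1.
Proof.
move=> bs bc cb; have cs := inv_sa bs bc cb; have c0 := nrm_ge0 c.
(* This [d] makes [|d c^2| < 1], so that [1 - d c^2] has a square root. *)
pose d := (1 + nrm c ^+ 2)^-1.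
have d0 : 0 < d by rewrite invr_gt0; nra.
pose r := d%:C *: (c * c).
have rs : st r = r by rewrite stZr stM cs.
have r1 : nrm r < 1.
  by rewrite nrmZr nrm_sa// gtr0_norm// mulrC ltr_pdivrMr; nra.
have [z [zs _ zE zc]] := sqrt_1B rs r1.
have sb : b * (1 - z) = (1 - z) * b.
  rewrite mulrBl mulrBr mul1r mulr1 zc//.
  by rewrite -scalerAr -scalerAl mulrA bc -mulrA cb mul1r mulr1.
(* As [c] inverts [b], [m^2 = b^2 (1 - d c^2) = b^2 - d]. *)
pose m := b * (1 - z).
have ms : st m = m by rewrite stM stB st1 zs bs -sb.
have mE : m * m = b * b - d%:C%:A.
  rewrite /m mulrA -(mulrA b) -sb mulrA -(mulrA (b * b)) zE mulrBr mulr1 -scalerAr.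
  by rewrite mulrA -(mulrA b b c) bc mulr1 bc.
pose N := nrm m + 1; have N0 : 0 < N by have := nrm_ge0 m; rewrite /N; lra.
have m's : st (N^-1%:C *: m) = N^-1%:C *: m by rewrite stZr ms.
have := nrm_1Bsq m's; rewrite nrmZr gtr0_norm ?invr_gt0// -scalerAr -scalerAl scalerA.
rewrite -rmorphM /= mE mulrC ltr_pdivrMr// mul1r => /(_ ltac:(rewrite /N; lra)) le1.
have D0 : 0 < N ^+ 2 + d by rewrite addr_gt0 ?exprn_gt0.
(* Since [|m / N| < 1], the norm of [1 - (b^2 - d) / N^2] is at most 1; for this [t], [1 - t b^2] is
   that element times [N^2 / (N^2 + d) < 1]. *)
exists (N ^+ 2 + d)^-1; first by rewrite invr_gt0.
have -> : 1 - (N ^+ 2 + d)^-1%:C *: (b * b) =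
    (N ^+ 2 / (N ^+ 2 + d))%:C *: (1 - (N^-1 * N^-1)%:C *: (b * b - d%:C%:A)).
  rewrite !scalerBr !scalerA -!rmorphM /= opprD opprK addrA -addrAC -scalerDl -raddfD.
  have E1 : N ^+ 2 / (N ^+ 2 + d) + N ^+ 2 / (N ^+ 2 + d) * (N^-1 / N) * d = 1.
    by field; rewrite !gt_eqF.
  have E2 : N ^+ 2 / (N ^+ 2 + d) * (N^-1 / N) = (N ^+ 2 + d)^-1.
    by field; rewrite !gt_eqF.
  by rewrite E1 E2 [_%:A]scale1r.
rewrite nrmZr gtr0_norm ?divr_gt0 ?exprn_gt0//.
rewrite mulrAC ltr_pdivrMr// mul1r; move: le1 => /(ler_wpM2l (ltW (exprn_gt0 2 N0))).
move: (nrm _) => w; rewrite mulr1; lra.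
Qed.

(* The polar decomposition: k b = u s with s > 0 and u = sign b. *)
Lemma polar b c : st b = b -> b * c = 1 -> c * b = 1 ->
  exists k u s, [/\ 0 < k, nrm (1 - s) < 1, st s = s,
    [/\ st u = u & u * u = 1] & k%:C *: b = u * s /\ u * s = s * u].
Proof.
move=> bs bc cb; have cs := inv_sa bs bc cb.
have [t t0 lt1] := nrm_1B_sq_lt bs bc cb.
(* Rescaling by [sqrt t] gives [|1 - b'^2| < 1]; then [s] is a square root of [b'^2], and [u = c' s]
   with [c'] the inverse of [b']. *)
pose k := Num.sqrt t; have k0 : 0 < k by rewrite sqrtr_gt0.
pose b' := k%:C *: b; pose c' := k^-1%:C *: c.
have b's : st b' = b' by rewrite stZr bs.
have c's : st c' = c' by rewrite stZr cs.
have b'c' : b' * c' = 1.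
  by rewrite -scalerAr -scalerAl scalerA -rmorphM /= mulVf ?gt_eqF// scale1r.
have c'b' : c' * b' = 1.
  by rewrite -scalerAr -scalerAl scalerA -rmorphM /= mulfV ?gt_eqF// scale1r.
have {}lt1 : nrm (1 - b' * b') < 1.
  rewrite -scalerAr -scalerAl scalerA -rmorphM /= -expr2 sqr_sqrtr//; exact: ltW.
have rs : st (1 - b' * b') = 1 - b' * b' by rewrite stB st1 stM b's.
have [z [zs zr zE zc]] := sqrt_1B rs lt1.
have ss : st (1 - z) = 1 - z by rewrite stB st1 zs.
rewrite subKr in zE.
have sc : c' * (1 - z) = (1 - z) * c'.
  rewrite mulrBl mulrBr mul1r mulr1 zc// mulrBr mulrBl mulr1 mul1r.
  by rewrite mulrA c'b' -mulrA b'c' mul1r mulr1.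
exists k, (c' * (1 - z)), (1 - z); split => //.
- by rewrite subKr; exact: le_lt_trans zr _.
- split; first by rewrite stM ss c's -sc.
  rewrite mulrA -(mulrA c') -sc mulrA -(mulrA (c' * c')) zE.
  by rewrite mulrA -(mulrA c') c'b' mulr1.
- split; last by rewrite {1}sc mulrA.
  by rewrite -mulrA zE mulrA c'b' mul1r.
Qed.

(* If p vanished, a - 1/2 would be close to -s/k, so that 3/4 - a would be a
   square d^2 commuting with h and |h|^2 <= |h^2 + d^2| = 3/4. *)
Lemma nonzero_idempotent_normalized h :
  (forall a, st a = a -> forall e : R, 0 < e -> exists b, [/\ st b = b,
    exists c, b * c = 1 /\ c * b = 1 & nrm (a - b) < e]) ->
  st h = h -> nrm h = 1 -> exists y, let f := h * h * y in f * f = f /\ f <> 0.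
Proof.
move=> dense hs h1; pose a := h * h.
have as_ : st a = a by rewrite stM hs.
have a2s : st (a - 2^-1%:C%:A) = a - 2^-1%:C%:A by rewrite stB as_ stZr st1.
(* The error [1/4] serves twice: [1/2 + 1/4 < |h|^2] makes [p] nonzero, and [1/4 < 1/2] makes the
   corner element invertible. *)
have [b [bs [c [bc cb]] ab]] := dense _ a2s 4^-1 ltac:(by rewrite invr_gt0).
set eta := a - _ - b in ab.
have [k [u [s [k0 s1 ss [us uu] [kb usC]]]]] := polar bs bc cb.
pose T := k^-1; have T0 : 0 < T by rewrite invr_gt0.
have bE : b = T%:C *: (u * s).
  by rewrite -kb scalerA -rmorphM /= mulVf ?gt_eqF// scale1r.
pose p := 2^-1%:C *: (1 + u).
have ps : st p = p by rewrite stZr stD st1 us.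
have pu : p * u = p by rewrite -scalerAl mulrDl mul1r uu addrC.
have pp : p * p = p by rewrite {2}/p -scalerAr mulrDr mulr1 pu scale_half.
have p1 := nrm_proj ps pp.
have pu1 : p = 0 -> u = -1.
  move=> p0; apply/eqP; rewrite -addr_eq0 addrC.
  by rewrite -[X in X == _]scale_half scalerDr -/p p0 addr0.
clearbody p.
have p0 : p <> 0.
  move=> /pu1 u1.
  (* With [u = -1], [M - (3/4 - a) = T (1 - s) + eta] has norm below [T + 1/4 = M]. *)
  pose M := T + 4^-1; have M0 : 0 < M by rewrite addr_gt0// invr_gt0.
  pose r := M^-1%:C *: (M%:C%:A - ((3 / 4)%:C%:A - a)).
  have rs : st r = r by rewrite stZr !stB !stZr st1 as_.
  have rE : M%:C%:A - ((3 / 4)%:C%:A - a) = T%:C *: (1 - s) + eta.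
    rewrite /eta bE u1 mulN1r scalerN opprK scalerBr.
    rewrite opprB [RHS]addrACA addNr addr0 addrCA [RHS]addrCA -!scalerBl -!raddfB /=.
    by do !congr (_ + _); congr (_%:C *: _); rewrite /M; field.
  have r1 : nrm r < 1.
    rewrite nrmZr rE gtr0_norm ?invr_gt0// mulrC ltr_pdivrMr// mul1r.
    have := nrmD (T%:C *: (1 - s)) eta; rewrite nrmZr gtr0_norm// /M.
    nra.
  have [z [zs _ zE zc]] := sqrt_1B rs r1.
  pose d := (Num.sqrt M)%:C *: (1 - z).
  have ds : st d = d by rewrite stZr stB st1 zs.
  have dd : d * d = (3 / 4)%:C%:A - a.
    rewrite -scalerAr -scalerAl scalerA -rmorphM /= -expr2 sqr_sqrtr ?ltW// zE.
    rewrite scalerBr scalerA -rmorphM /= mulfV ?gt_eqF// rmorph1 scale1r.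
    by rewrite subKr.
  have hd : h * d = d * h.
    rewrite -scalerAr -scalerAl mulrBl mulrBr mul1r mulr1 zc//.
    rewrite -scalerAr -scalerAl !mulrBr !mulrBl -!scalerAr -!scalerAl !mulr1 !mul1r.
    by rewrite /a mulrA.
  have := nrm_sq_le hs ds hd; rewrite dd addrC subrK nrmZr h1 gtr0_norm//.
  by have := nrm1; lra.
(* Now [M - a = T - b - eta] and [p b = T p s], so [p (M - a) p = p w p] has norm below [M], and
   [p a p = M p (1 - x)]. *)
pose M := T + 2^-1; have M0 : 0 < M by rewrite addr_gt0// invr_gt0.
pose w := T%:C *: (1 - s) - eta.
have pb : p * b = T%:C *: (p * s) by rewrite bE -scalerAr mulrA pu.
have pMa : p * (M%:C%:A - a) * p = p * w * p.
  have -> : M%:C%:A - a = T%:C%:A - b - eta.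
    by rewrite /eta !opprB addrA subrK addrA -scalerDl -raddfD.
  by rewrite /w !mulrBr pb -!scalerAr !mulrBr !mulr1 scalerBr.
pose x := M^-1%:C *: (p * w * p).
have x1 : nrm x < 1.
  rewrite nrmZr gtr0_norm ?invr_gt0// mulrC ltr_pdivrMr// mul1r.
  have : nrm (p * w * p) <= nrm w.
    apply: le_trans (nrmM _ _) _; apply: le_trans (ler_piMr (nrm_ge0 _) p1) _.
    by apply: le_trans (nrmM _ _) _; apply: ler_piMl; rewrite ?nrm_ge0.
  have := nrmB (T%:C *: (1 - s)) eta; rewrite nrmZr gtr0_norm// /M.
  rewrite -/w; nra.
have [g gE] := neumann x1.
have pap : p * a * p * (M^-1%:C *: g) = p.
  have px : p * x = x by rewrite -scalerAr !mulrA pp.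
  have -> : p * a * p = M%:C *: (p * (1 - x)).
    rewrite mulrBr mulr1 px /x -pMa scalerBr scalerA -rmorphM /= mulfV ?gt_eqF// scale1r.
    by rewrite mulrBr mulrBl -scalerAr mulr1 -scalerAl pp subKr.
  rewrite -scalerAr -scalerAl scalerA -rmorphM /= mulVf ?gt_eqF// scale1r.
  by rewrite -mulrA gE mulr1.
(* Here [p f = p]; hence [y f = y] and [f f = f], while [f = 0] would give [p = 0]. *)
exists (p * (M^-1%:C *: g) * p) => f.
have pf : p * f = p.
  by rewrite /f !mulrA -(mulrA p h h) -/a pap pp.
split; last by move=> f0; apply: p0; rewrite -pf f0 mulr0.
by rewrite {1}/f -!mulrA pf /f !mulrA.
Qed.

Lemma nonzero_idempotent h :
  (forall a, st a = a -> forall e : R, 0 < e -> exists b, [/\ st b = b,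
    exists c, b * c = 1 /\ c * b = 1 & nrm (a - b) < e]) ->
  st h = h -> h <> 0 -> exists y, let f := h * h * y in f * f = f /\ f <> 0.
Proof.
move=> dense hs h0; pose k := (nrm h)^-1.
have nh : 0 < nrm h.
  by rewrite lt_def nrm_ge0 andbT; apply/eqP => /nrm_eq0.
have [||y yP] := @nonzero_idempotent_normalized (k%:C *: h) dense.
- by rewrite stZr hs.
- by rewrite nrmZr gtr0_norm ?invr_gt0// mulVf ?gt_eqF.
exists (k%:C *: (k%:C *: y)); move: yP.
by rewrite -!scalerAr -!scalerAl.
Qed.

End UnitalCStar.

(** * C*-algebras and their unitizations *)

Section GeometricSequences.
Variables (R : realType) (W : zmodType) (nrm : W -> R).
Hypothesis nrmD : forall x y, nrm (x + y) <= nrm x + nrm y.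
Hypothesis nrm0 : nrm 0 = 0.

(** The increments sum to a geometric series; the induction peels off the first one. *)
Lemma geometric_dist (u : nat -> W) (C r : R) : 0 <= C -> 0 <= r < 1 ->
  (forall n, nrm (u n.+1 - u n) <= C * r ^+ n) ->
  forall m n, (n <= m)%N -> nrm (u m - u n) <= C / (1 - r) * r ^+ n.
Proof.
move=> C0 /andP[r0 r1] ur; suff H k n : nrm (u (n + k)%N - u n) <= C / (1 - r) * r ^+ n.
  by move=> m n /subnKC <-; apply: H.
elim: k n => [|k IH] n.
  by rewrite addn0 subrr nrm0 mulr_ge0 ?exprn_ge0// divr_ge0// subr_ge0 ltW.
have -> : u (n + k.+1)%N - u n = (u (n.+1 + k)%N - u n.+1) + (u n.+1 - u n).
  by rewrite addrA subrK addnS addSn.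
apply: le_trans (nrmD _ _) _; apply: le_trans (lerD (IH _) (ur n)) _.
rewrite exprS le_eqVlt; apply/orP; left; apply/eqP; field.
by rewrite subr_eq0 gt_eqF.
Qed.

Lemma geometric_eventually (C r e : R) : 0 <= C -> 0 <= r < 1 -> 0 < e ->
  exists N, forall n, (N <= n)%N -> C * r ^+ n < e.
Proof.
move=> C0 /andP[r0 r1] e0.
have : (geometric C r @ \oo --> (0 : R))%classic.
  by apply: cvg_geometric; rewrite ger0_norm.
move=> /cvgrPdist_lt/(_ _ e0)[N _ H]; exists N => n /H /=.
by rewrite sub0r normrN ger0_norm// mulr_ge0 ?exprn_ge0.
Qed.

End GeometricSequences.

(** Completeness of [V] refers to a [K]-valued norm; [emb] translates it to the real-valued [nrm],
    for [K = R] and for [K = R[i]]. *)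
Lemma geometric_complete (R : realType) (K : numFieldType) (V : completeNormedModType K)
    (emb : R -> K) (nrm : V -> R) :
  (forall x y, nrm (x + y) <= nrm x + nrm y) ->
  nrm 0 = 0 ->
  (forall x, nrm (- x) = nrm x) ->
  (forall k : K, 0 < k -> exists2 e : R, 0 < e & emb e = k) ->
  (forall x e, (`|x| < emb e) = (nrm x < e)) ->
  forall (u : nat -> V) (C r : R), 0 <= r < 1 ->
    (forall n, nrm (u n.+1 - u n) <= C * r ^+ n) ->
  exists l, forall e, 0 < e -> exists N, forall n, (N <= n)%N -> nrm (u n - l) < e.
Proof.
move=> nrmD nrm0 nrmN embP embE u C r r01 ur.
have nrm_ge0 x : 0 <= nrm x.
  have := nrmD x (- x); rewrite subrr nrm0 nrmN; lra.
have C0 : 0 <= C.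
  by have := ur 0%N; rewrite expr0 mulr1; apply: le_trans.
have r1 : 0 < 1 - r by case/andP: r01; lra.
(* The factor 2 comes from comparing both [u m] and [u n] with [u N]. *)
have D0 : 0 <= 2 * (C / (1 - r)) by rewrite mulr_ge0// divr_ge0// ltW.
have near_u e : 0 < e -> exists N, forall m n, (N <= m)%N -> (N <= n)%N ->
    nrm (u m - u n) < e.
  move=> e0; have [N NP] := geometric_eventually D0 r01 e0.
  exists N => m n Nm Nn.
  have -> : u m - u n = (u m - u N) - (u n - u N) by rewrite opprB addrA subrK.
  apply: le_lt_trans (nrmD _ _) _; rewrite nrmN.
  have := geometric_dist nrmD nrm0 C0 r01 ur Nm.
  have := geometric_dist nrmD nrm0 C0 r01 ur Nn.
  have := NP N (leqnn N); lra.
have uC : cauchy (u @ \oo)%classic.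
  apply: cauchy_exP => k k0; have [e e0 <-] := embP k k0.
  have [N NP] := near_u e e0; exists (u N), N => // n Nn.
  by rewrite /= -ball_normE /= embE; apply: NP.
have /cvg_ex[l /cvgrPdist_lt ul] : cvg (u @ \oo)%classic by apply/cauchy_cvgP.
exists l => e e0; have e0' : 0 < emb e by rewrite -(normr0 V) embE nrm0.
have [N _ NP] := ul _ e0'; exists N => n /NP /=.
by rewrite embE -opprB nrmN.
Qed.

Lemma real_complete (R : realType) (u : nat -> R) (C r : R) : 0 <= r < 1 ->
  (forall n, `|u n.+1 - u n| <= C * r ^+ n) ->
  exists l, forall e, 0 < e -> exists N, forall n, (N <= n)%N -> `|u n - l| < e.
Proof.
apply: (@geometric_complete R R R^o id (fun x => `|x|)).
- exact: ler_normD.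
- exact: normr0.
- exact: normrN.
- by move=> k k0; exists k.
- by [].
Qed.

Lemma Re_norm_bounds (R : realType) (z : R[i]) :
  [/\ `|complex.Re z| <= complex.Re `|z|, `|complex.Im z| <= complex.Re `|z| &
      complex.Re `|z| <= `|complex.Re z| + `|complex.Im z|].
Proof.
case: z => a b; rewrite normc_def /=.
have a0 := sqr_ge0 a; have b0 := sqr_ge0 b; split.
- by rewrite -sqrtr_sqr ler_wsqrtr// lerDl.
- by rewrite -[leLHS]sqrtr_sqr ler_wsqrtr// lerDr.
- rewrite -[leRHS]ger0_norm ?addr_ge0// -sqrtr_sqr ler_wsqrtr//.
  by rewrite sqrrD !real_normK ?num_real// lerD2r lerDl mulrn_wge0// mulr_ge0.
Qed.

Lemma complex_complete (R : realType) (u : nat -> R[i]) (C r : R) : 0 <= r < 1 ->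
  (forall n, complex.Re `|u n.+1 - u n| <= C * r ^+ n) ->
  exists k, forall e, 0 < e ->
    exists N, forall n, (N <= n)%N -> complex.Re `|u n - k| < e.
Proof.
move=> r01 ur.
have ReB (x y : R[i]) : complex.Re (x - y) = complex.Re x - complex.Re y.
  by case: x y => [? ?] [].
have ImB (x y : R[i]) : complex.Im (x - y) = complex.Im x - complex.Im y.
  by case: x y => [? ?] [].
have [|a aP] := @real_complete R (fun n => complex.Re (u n)) C r r01.
  move=> n; rewrite -ReB; have [le_Re _ _] := Re_norm_bounds (u n.+1 - u n).
  exact: le_trans le_Re (ur n).
have [|b bP] := @real_complete R (fun n => complex.Im (u n)) C r r01.
  move=> n; rewrite -ImB; have [_ le_Im _] := Re_norm_bounds (u n.+1 - u n).
  exact: le_trans le_Im (ur n).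
exists (a +i* b) => e e0; have e2 : 0 < e / 2 by rewrite divr_gt0.
have [N NP] := aP _ e2; have [M MP] := bP _ e2.
exists (maxn N M) => n; rewrite geq_max => /andP[/NP + /MP].
have [_ _ +] := Re_norm_bounds (u n - (a +i* b)); rewrite ReB ImB /=.
lra.
Qed.

(** * The real-valued norm underlying the [R[i]]-valued one *)

Section CStarNorm.
Variables (R : realType) (A : cstarAlgType R).
Implicit Types (x y z c : A) (k : R[i]).

Definition cnorm x : R := complex.Re `|x|.

Lemma cnormE x : `|x| = (cnorm x)%:C.
Proof. by rewrite RRe_real// ger0_real. Qed.

Lemma real_normE k : `|k| = (complex.Re `|k|)%:C.
Proof. by rewrite RRe_real// ger0_real. Qed.

Lemma Re_norm_ge0 k : 0 <= complex.Re `|k|.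
Proof. by rewrite -lecR -real_normE normr_ge0. Qed.

Lemma cnorm_ge0 x : 0 <= cnorm x.
Proof. by rewrite -lecR -cnormE normr_ge0. Qed.

Lemma cnorm0 : cnorm 0 = 0.
Proof. by rewrite /cnorm normr0. Qed.

Lemma cnorm_eq0 x : cnorm x = 0 -> x = 0.
Proof. by move=> x0; apply/normr0_eq0; rewrite cnormE x0. Qed.

Lemma cnormN x : cnorm (- x) = cnorm x.
Proof. by rewrite /cnorm normrN. Qed.

Lemma cnormD x y : cnorm (x + y) <= cnorm x + cnorm y.
Proof. by rewrite -lecR rmorphD /= -!cnormE ler_normD. Qed.

Lemma cnormZ k x : cnorm (k *: x) = complex.Re `|k| * cnorm x.
Proof.
by apply: (fmorph_inj (real_complex R)); rewrite rmorphM /= -!cnormE -real_normE normrZ.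
Qed.

Lemma cnorm_mul x y : cnorm (x ** y) <= cnorm x * cnorm y.
Proof. by rewrite -lecR rmorphM /= -!cnormE cnormM. Qed.

Lemma cnorm_starM x : cnorm (star x ** x) = cnorm x ^+ 2.
Proof. by rewrite {1}/cnorm cnorm_star cnormE -rmorphXn. Qed.

Lemma star0 : star (0 : A) = 0.
Proof. by apply: (addrI (star 0)); rewrite -starD !addr0. Qed.

Lemma star_mul_eq0 x : star x ** x = 0 -> x = 0.
Proof.
move=> x0; apply/cnorm_eq0/eqP; rewrite -sqrf_eq0 -cnorm_starM x0.
by rewrite cnorm0.
Qed.

Lemma mul_star_eq0 x : x ** star x = 0 -> x = 0.
Proof.
by move=> x0; rewrite -(starK x) (@star_mul_eq0 (star x)) ?star0// starK.
Qed.

Lemma cnorm_star_eq x : cnorm (star x) = cnorm x.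
Proof.
suff le y : cnorm y <= cnorm (star y) by apply/eqP; rewrite eq_le le -{2}(starK x) le.
have [->|y0] := eqVneq (cnorm y) 0; first exact: cnorm_ge0.
have {}y0 : 0 < cnorm y by rewrite lt_def y0 cnorm_ge0.
by have := cnorm_mul (star y) y; rewrite cnorm_starM expr2 ler_pM2r.
Qed.

Lemma cnorm_complete (u : nat -> A) (C r : R) : 0 <= r < 1 ->
    (forall n, cnorm (u n.+1 - u n) <= C * r ^+ n) ->
  exists l, forall e, 0 < e -> exists N, forall n, (N <= n)%N -> cnorm (u n - l) < e.
Proof.
apply: (@geometric_complete R _ A (fun t => t%:C)).
- exact: cnormD.
- exact: cnorm0.
- exact: cnormN.
- move=> k k0; exists (complex.Re k); last by rewrite RRe_real// ger0_real// ltW.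
  by rewrite -ltcR RRe_real// ger0_real// ltW.
- by move=> x e; rewrite cnormE ltcR.
Qed.

End CStarNorm.

(** * Real rank zero for algebras with unit *)

Section Unital.
Variables (R : realType) (A : cstarAlgType R) (e : A).
Hypotheses (eP : is_rng_unit e) (e0 : e != 0).

(** A copy of [A] indexed by the proofs about [e], so that an algebra structure with unit [e] can be
    attached to it. *)
Definition unital_alg & is_rng_unit e & e != 0 : Type := A.
Let U := unital_alg eP e0.

HB.instance Definition _ := GRing.Lmodule.on U.

Let mulU : U -> U -> U := fun x y => (x : A) ** (y : A).

Let mulUA : associative mulU. Proof. exact: rmulA. Qed.
Let mul1U : left_id (e : U) mulU. Proof. by move=> x; exact: (eP x).1. Qed.
Let mulU1 : right_id (e : U) mulU. Proof. by move=> x; exact: (eP x).2. Qed.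
Let mulUDl : left_distributive mulU +%R. Proof. exact: rmulDl. Qed.
Let mulUDr : right_distributive mulU +%R. Proof. exact: rmulDr. Qed.

HB.instance Definition _ := GRing.Zmodule_isNzRing.Build U
  mulUA mul1U mulU1 mulUDl mulUDr e0.
HB.instance Definition _ := GRing.Lmodule_isLalgebra.Build R[i] U
  (@cscalerAl R A).
HB.instance Definition _ := GRing.Lalgebra_isAlgebra.Build R[i] U
  (@cscalerAr R A).

Lemma unital_cstar_alg : @unital_cstar R U (@star R A) (@cnorm R A).
Proof.
split.
- exact: starK.
- exact: starD.
- exact: starZ.
- exact: starM.
- exact: cnormD.
- exact: cnormZ.
- exact: cnorm_mul.
- by move=> x; rewrite -cnorm_starM.
- exact: cnorm_eq0.
- exact: cnorm_complete.
Qed.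

(** For [h = x (star x)], the idempotent [h h y] is a right multiple of [x]. *)
Lemma unital_idempotent_multiples :
  invertible_selfadjoint_dense (@star R A) (@cnorm R A) -> has_idempotent_multiples A.
Proof.
move=> [e' [e'P dense]] x x0.
have e'E : e' = e by rewrite -(e'P e).1 (eP e').2.
have hs : star (x ** star x) = x ** star x by rewrite starM starK.
have h0 : x ** star x <> 0 by move=> /mul_star_eq0.
have [a as_ eps eps0|y [yy y0]] := @nonzero_idempotent R U (@star R A) (@cnorm R A)
    unital_cstar_alg (x ** star x) _ hs h0.
  have [b [bs [c bc] ab]] := dense a as_ eps eps0.
  by exists b; split=> //; exists c; move: bc; rewrite e'E.
exists (star x ** (x ** star x) ** y).
have -> : x ** (star x ** (x ** star x) ** y) = (x ** star x) ** (x ** star x) ** y.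
  by rewrite !rmulA.
by split; [exact: yy|exact: y0].
Qed.

End Unital.

(** * The unitization with its operator norm *)

Section UnitizationAlgebra.
Variables (R : realType) (A : cstarAlgType R).
Local Notation At := (unitization A).
Implicit Types (X Y : At) (c d : A) (k : R[i]).

Definition uz1 : At := (0, 1).

Let uz_mul1l : left_id uz1 (@uz_mul R A).
Proof.
by move=> [x k]; rewrite /uz_mul /= rmul0l scale1r scaler0 addr0 add0r mul1r.
Qed.

Let uz_mul1r : right_id uz1 (@uz_mul R A).
Proof.
by move=> [x k]; rewrite /uz_mul /= rmul0r scale1r scaler0 !add0r mulr1.
Qed.

Let uz1_neq0 : uz1 != 0.
Proof. by apply/eqP => /(congr1 snd)/eqP; rewrite oner_eq0. Qed.

HB.instance Definition _ := GRing.Zmodule_isNzRing.Build At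
  (@uz_mulA R A) uz_mul1l uz_mul1r (@uz_mulDl R A) (@uz_mulDr R A) uz1_neq0.

Definition uz_scale k X : At := (k *: X.1, k * X.2).

Let uz_scaleA k l X : uz_scale k (uz_scale l X) = uz_scale (k * l) X.
Proof. by rewrite /uz_scale /= scalerA mulrA. Qed.

Let uz_scale1 : left_id 1 uz_scale.
Proof. by move=> [x k]; rewrite /uz_scale /= scale1r mul1r. Qed.

Let uz_scaleDr : right_distributive uz_scale +%R.
Proof. by move=> k [x l] [y m]; rewrite /uz_scale /= scalerDr mulrDr. Qed.

Let uz_scaleDl X : {morph uz_scale^~ X : k l / k + l}.
Proof. by move=> k l; rewrite /uz_scale /= scalerDl mulrDl. Qed.

HB.instance Definition _ := GRing.Zmodule_isLmodule.Build R[i] At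
  uz_scaleA uz_scale1 uz_scaleDr uz_scaleDl.

Let uz_scaleAl k X Y : k *: (X * Y) = (k *: X) * Y.
Proof.
case: X Y => [x l] [y m]; congr pair; last exact: mulrA.
by rewrite /= !scalerDr cscalerAl !scalerA [k * m]mulrC.
Qed.

Let uz_scaleAr k X Y : k *: (X * Y) = X * (k *: Y).
Proof.
case: X Y => [x l] [y m]; congr pair; last exact: mulrCA.
by rewrite /= !scalerDr cscalerAr !scalerA [k * l]mulrC.
Qed.

HB.instance Definition _ := GRing.Lmodule_isLalgebra.Build R[i] At uz_scaleAl.
HB.instance Definition _ := GRing.Lalgebra_isAlgebra.Build R[i] At uz_scaleAr.

Definition uz_act X (c : A) : A := X.1 ** c + X.2 *: c.

Lemma uz_actM X Y c : uz_act (X * Y) c = uz_act X (uz_act Y c).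
Proof.
rewrite /uz_act /= !rmulDl !rmulDr !scalerDr !scalerA !rmulA -!cscalerAl -!cscalerAr.
by rewrite -!addrA; congr (_ + _); rewrite addrCA.
Qed.

Lemma uz_actDl X Y c : uz_act (X + Y) c = uz_act X c + uz_act Y c.
Proof. by rewrite /uz_act /= rmulDl scalerDl addrACA. Qed.

Lemma uz_actZl k X c : uz_act (k *: X) c = k *: uz_act X c.
Proof. by rewrite /uz_act /= scalerDr -cscalerAl scalerA. Qed.

Lemma uz_actZr k X c : uz_act X (k *: c) = k *: uz_act X c.
Proof. by rewrite /uz_act scalerDr -cscalerAr !scalerA mulrC. Qed.

(** For the [A]-valued inner product [(star c) d], the adjoint of the action of [X] is the action of
    [uz_star X]. *)
Lemma uz_act_star X c d : star (uz_act X c) ** d = star c ** uz_act (uz_star X) d.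
Proof.
by rewrite /uz_act /= starD starM starZ rmulDl rmulDr rmulA -cscalerAl -cscalerAr.
Qed.

Lemma cnorm_le1 c : (`|c| <= 1) = (cnorm c <= 1).
Proof. by rewrite cnormE -[1 in LHS]/(1%:C) lecR. Qed.

Lemma uz_norm_has_sup X :
  has_sup [set complex.Re `|X.1 ** c + X.2 *: c| | c in [set c : A | `|c| <= 1]]%classic.
Proof.
split; first by exists (cnorm (uz_act X 0)), 0 => //=; rewrite normr0 ler01.
exists (cnorm X.1 + complex.Re `|X.2|) => _ [c /= + <-]; rewrite cnorm_le1 => c1.
apply: le_trans (cnormD _ _) _; apply: lerD.
  by apply: le_trans (cnorm_mul _ _) _; apply: ler_piMr; rewrite ?cnorm_ge0.
by rewrite cnormZ; apply: ler_piMr => //; exact: Re_norm_ge0.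
Qed.

Lemma uz_norm_act X c : cnorm (uz_act X c) <= uz_norm X * cnorm c.
Proof.
have [->|c0] := eqVneq c 0.
  by rewrite /uz_act rmul0r scaler0 addr0 cnorm0 mulr0.
have {}c0 : 0 < cnorm c.
  by rewrite lt_def cnorm_ge0 andbT; apply: contra_neq c0; apply: cnorm_eq0.
pose t := (cnorm c)^-1; have t0 : 0 < t by rewrite invr_gt0.
have Zt x : cnorm (t%:C *: x) = t * cnorm x.
  by rewrite cnormZ normc_def /= expr0n addr0 sqrtr_sqr gtr0_norm.
have := ub_le_sup (uz_norm_has_sup X).2 (x := cnorm (uz_act X (t%:C *: c))).
rewrite uz_actZr Zt mulrC ler_pdivrMr//; apply.
exists (t%:C *: c); last by rewrite -[LHS]/(cnorm (uz_act _ _)) uz_actZr Zt mulrC.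
by rewrite /= cnorm_le1 Zt mulVf// gt_eqF.
Qed.

Lemma uz_norm_le X (M : R) : 0 <= M ->
  (forall c, cnorm (uz_act X c) <= M * cnorm c) -> uz_norm X <= M.
Proof.
move=> M0 XM; apply: ge_sup; first exact: (uz_norm_has_sup X).1.
move=> _ [c /= + <-]; rewrite cnorm_le1 => c1.
by apply: le_trans (XM c) _; apply: ler_piMr.
Qed.

Lemma uz_norm_le_sum X : uz_norm X <= cnorm X.1 + complex.Re `|X.2|.
Proof.
apply: uz_norm_le => [|c]; first by rewrite addr_ge0 ?cnorm_ge0 ?Re_norm_ge0.
by rewrite mulrDl -cnormZ (le_trans (cnormD _ _))// lerD// cnorm_mul.
Qed.

Lemma uz_norm_ge0 X : 0 <= uz_norm X.
Proof.
apply: le_trans (cnorm_ge0 (uz_act X 0)) _.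
apply: (ub_le_sup (uz_norm_has_sup X).2); exists 0 => //=.
by rewrite normr0 ler01.
Qed.

(** Acting on [star x] shows that the bound [|x|] is sharp, since [|x (star x)| = |x|^2]. *)
Lemma uz_norm_in x : uz_norm ((x, 0) : At) = cnorm x.
Proof.
apply/eqP; rewrite eq_le uz_norm_le ?cnorm_ge0//= => [|c]; last first.
  by rewrite /uz_act /= scale0r addr0 cnorm_mul.
have [x0|x0] := eqVneq (cnorm x) 0; first by rewrite x0 uz_norm_ge0.
have {}x0 : 0 < cnorm x by rewrite lt_def x0 cnorm_ge0.
have := uz_norm_act (x, 0) (star x); rewrite /uz_act /= scale0r addr0 cnorm_star_eq.
by rewrite -{1}(starK x) cnorm_starM cnorm_star_eq expr2 ler_pM2r.
Qed.

Lemma uz_normD X Y : uz_norm (X + Y) <= uz_norm X + uz_norm Y.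
Proof.
apply: uz_norm_le => [|c]; first by rewrite addr_ge0 ?uz_norm_ge0.
by rewrite uz_actDl mulrDl (le_trans (cnormD _ _))// lerD ?uz_norm_act.
Qed.

(** One inequality, applied to [k^-1] and [k X], yields the other. *)
Lemma uz_normZ k X : uz_norm (k *: X) = complex.Re `|k| * uz_norm X.
Proof.
have le l Y : uz_norm (l *: Y) <= complex.Re `|l| * uz_norm Y.
  apply: uz_norm_le => [|c]; first by rewrite mulr_ge0 ?uz_norm_ge0 ?Re_norm_ge0.
  by rewrite uz_actZl cnormZ -mulrA ler_wpM2l ?uz_norm_act ?Re_norm_ge0.
have [->|kn0] := eqVneq k 0.
  apply/eqP; rewrite eq_le le normr0 /= mul0r; exact: uz_norm_ge0.
apply/eqP; rewrite eq_le le /=.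
have := le k^-1 (k *: X); rewrite scalerA mulVf// scale1r.
move=> /(ler_wpM2l (Re_norm_ge0 k)) /le_trans; apply.
rewrite mulrA le_eqVlt; apply/orP; left; apply/eqP.
rewrite -[RHS]mul1r; congr (_ * _); apply: (fmorph_inj (real_complex R)).
by rewrite rmorphM /= -!real_normE -normrM mulfV// normr1.
Qed.

Lemma uz_normM X Y : uz_norm (X * Y) <= uz_norm X * uz_norm Y.
Proof.
apply: uz_norm_le => [|c]; first by rewrite mulr_ge0 ?uz_norm_ge0.
rewrite uz_actM (le_trans (uz_norm_act _ _))// -mulrA ler_wpM2l ?uz_norm_ge0//.
exact: uz_norm_act.
Qed.

(** [|X c|^2 = |star (X c) (X c)| = |(star c) (X^* X c)| <= |X^* X| |c|^2]. *)
Lemma uz_norm_star X : uz_norm X ^+ 2 <= uz_norm (uz_star X * X).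
Proof.
set M := uz_norm (_ * _); have M0 : 0 <= M by exact: uz_norm_ge0.
have : uz_norm X <= Num.sqrt M.
  apply: uz_norm_le => [|c]; first exact: sqrtr_ge0.
  rewrite -(@ler_pXn2r _ 2)// ?nnegrE ?mulr_ge0 ?sqrtr_ge0 ?cnorm_ge0//.
  rewrite -cnorm_starM uz_act_star -uz_actM (le_trans (cnorm_mul _ _))//.
  rewrite cnorm_star_eq exprMn sqr_sqrtr// mulrC expr2 mulrA.
  by rewrite ler_wpM2r ?cnorm_ge0// uz_norm_act.
by move=> /(lerXn2r 2 (uz_norm_ge0 _) (sqrtr_ge0 _)); rewrite sqr_sqrtr.
Qed.

Hypothesis nonunital : ~ exists e : A, is_rng_unit e.

(* If |(x, 1)| < 1 then -x_n, the A-component of -(x, 1)^n, converges to a unit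
   of A. *)
Lemma uz_norm_scalar X : complex.Re `|X.2| <= uz_norm X.
Proof.
rewrite leNgt; apply/negP => lt.
have k0 : X.2 != 0.
  by apply: contraTneq lt => ->; rewrite normr0 -leNgt uz_norm_ge0.
pose Y := X.2^-1 *: X; have Y2 : Y.2 = 1 by rewrite /Y /= mulVf.
have Y1 : uz_norm Y < 1.
  rewrite uz_normZ -(ltr_pM2l (x := complex.Re `|X.2|)); last first.
    by rewrite -ltcR -real_normE normr_gt0.
  rewrite mulrA mulr1 (_ : complex.Re `|X.2| * _ = 1) ?mul1r//.
  apply: (fmorph_inj (real_complex R)).
  by rewrite rmorphM /= -!real_normE -normrM mulfV// normr1.
clearbody Y; pose u n := (Y ^+ n).1.
have Yn n : Y ^+ n = (u n, 1).
  have : (Y ^+ n).2 = 1 by elim: n => //= n IH; rewrite exprS /= IH mulr1 Y2.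
  by rewrite /u; case: (Y ^+ n) => a b /= ->.
have Yle n : uz_norm (Y ^+ n.+1) <= uz_norm Y ^+ n.+1.
  elim: n => // n IH; rewrite exprS (le_trans (uz_normM _ _))// [leRHS]exprS.
  by rewrite ler_wpM2l ?uz_norm_ge0.
have Y01 : 0 <= uz_norm Y < 1 by rewrite uz_norm_ge0.
have [|y yP] := @cnorm_complete _ A (fun n => u n.+1) (uz_norm Y * cnorm Y.1) _ Y01.
  move=> n; rewrite -uz_norm_in.
  (* Both sides are [Y^(n+1) (Y - 1)], whence the geometric bound. *)
  have -> : (u n.+2 - u n.+1, 0) = Y ^+ n.+1 * (Y.1, 0).
    have pair1 a : ((a, 0) : At) = ((a, 1) : At) - 1.
      by congr pair; rewrite /= ?subr0 ?subrr.
    rewrite pair1 -Y2 -surjective_pairing.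
    by rewrite mulrBr mulr1 -exprSr !Yn; congr pair; rewrite /= subrr.
  rewrite (le_trans (uz_normM _ _))// uz_norm_in mulrAC -exprS.
  by rewrite ler_wpM2r ?cnorm_ge0.
(* [Y^n c = u n c + c] tends to 0 because [|Y| < 1]. *)
have yc c : y ** c + c = 0.
  apply/cnorm_eq0/eqP; rewrite eq_le cnorm_ge0 andbT.
  apply/ler_addgt0Pr => eps eps0; rewrite add0r.
  pose K := 2 * (1 + cnorm c); have K0 : 0 < K by have := cnorm_ge0 c; rewrite /K; lra.
  have eK : 0 < eps / K by rewrite divr_gt0.
  have [N yN] := yP _ eK; have [M rM] := geometric_eventually ler01 Y01 eK.
  pose n := maxn N M; have := yN n (leq_maxl _ _).
  have := rM n.+1 (leqW (leq_maxr _ _)); rewrite mul1r.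
  rewrite !ltr_pdivlMr// => Ye ye.
  have -> : y ** c + c = uz_act (Y ^+ n.+1) c - (u n.+1 - y) ** c.
    have uc : u n.+1 ** c = (u n.+1 - y) ** c + y ** c by rewrite -rmulDl subrK.
    by rewrite Yn /uz_act /= scale1r uc [RHS]addrC !addrA addNr add0r.
  apply: le_trans (cnormD _ _) _; rewrite cnormN.
  have := uz_norm_act (Y ^+ n.+1) c; have := cnorm_mul (u n.+1 - y) c.
  have := Yle n; have := cnorm_ge0 c; have := cnorm_ge0 (u n.+1 - y).
  move: Ye ye; rewrite /K.
  move: (cnorm c) (cnorm (u n.+1 - y)) (_ ^+ n.+1) (uz_norm (Y ^+ n.+1))
    (cnorm (uz_act _ _)) (cnorm (_ ** _)) => *; nra.
have yl c : (- y) ** c = c.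
  by apply: (addrI (y ** c)); rewrite -rmulDl subrr rmul0l yc.
apply: nonunital; exists (- y).
(* The adjoint of a left unit is a right unit, and the product of [-y] with its adjoint equals
   both. *)
have yr c : c ** star (- y) = c by rewrite -(starK c) -starM yl.
move=> c; split; first exact: yl.
by rewrite -[X in c ** X](yr (- y)) yl yr.
Qed.

(** [uz_norm_scalar] bounds the scalar part by the norm; this gives definiteness and reduces
    completeness to the two components. *)
Lemma uz_star_cstar : @unital_cstar R At (@uz_star R A) (@uz_norm R A).
Proof.
split.
- by move=> [x k]; rewrite /uz_star /= starK conjCK.
- by move=> [x k] [y l]; rewrite /uz_star /= starD rmorphD.
- by move=> k [x l]; rewrite /uz_star /= starZ rmorphM.
- move=> [x k] [y l]; congr pair; last by rewrite /= rmorphM mulrC.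
  by rewrite /= !starD starM !starZ addrAC.
- exact: uz_normD.
- exact: uz_normZ.
- exact: uz_normM.
- exact: uz_norm_star.
- move=> [x k] n0; have k0 : k = 0.
    apply/normr0_eq0; rewrite real_normE (_ : complex.Re _ = 0)//.
    by apply/eqP; rewrite eq_le Re_norm_ge0 andbT -n0; exact: (uz_norm_scalar (x, k)).
  by move: n0; rewrite k0 uz_norm_in => /cnorm_eq0 ->.
move=> u C r r01 ur.
have urk n : complex.Re `|(u n.+1).2 - (u n).2| <= C * r ^+ n.
  exact: le_trans (uz_norm_scalar (u n.+1 - u n)) (ur n).
(* Removing the scalar part from the increment costs a second [C r^n], hence the factor 2. *)
have urx n : cnorm ((u n.+1).1 - (u n).1) <= 2 * C * r ^+ n.
  rewrite -uz_norm_in.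
  have -> : (((u n.+1).1 - (u n).1, 0) : At) =
      (u n.+1 - u n) + (- ((u n.+1).2 - (u n).2)) *: (1 : At).
    by congr pair; rewrite /= ?scaler0 ?addr0// mulr1 subrr.
  rewrite (le_trans (uz_normD _ _))// uz_normZ normrN.
  have one : uz_norm (1 : At) <= 1.
    by apply: uz_norm_le => // c; rewrite /uz_act /= rmul0l scale1r add0r mul1r.
  have := ur n; have := urk n; have := Re_norm_ge0 ((u n.+1).2 - (u n).2).
  have := uz_norm_ge0 (1 : At). move: one. nra.
have [x xP] := cnorm_complete r01 urx.
have [k kP] := complex_complete r01 urk.
exists (x, k) => e e0; have e2 : 0 < e / 2 by rewrite divr_gt0.
have [N NP] := xP _ e2; have [M MP] := kP _ e2.
exists (maxn N M) => n; rewrite geq_max => /andP[/NP xe /MP ke].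
apply: le_lt_trans (uz_norm_le_sum _) _; move: xe ke => /=. lra.
Qed.

(** [A] is an ideal of its unitization, so the idempotent obtained from [h = (x (star x), 0)] lies
    in [A] and is a right multiple of [x]. *)
Lemma unitization_idempotent_multiples :
  invertible_selfadjoint_dense (@uz_star R A) (@uz_norm R A) ->
  has_idempotent_multiples A.
Proof.
move=> [e [eP dense]] x x0.
have e1 : e = 1 by rewrite -(mul1r e); exact: (eP (1 : At)).2.
pose w := x ** star x; pose h : At := (w, 0).
have hs : uz_star h = h by rewrite /h /uz_star /= starM starK rmorph0.
have h0 : h <> 0 by case=> /mul_star_eq0.
have [a as_ eps eps0|Y [ff f0]] := nonzero_idempotent uz_star_cstar _ hs h0.
  have [b [bs [c bc] ab]] := dense a as_ eps eps0.
  by exists b; split=> //; exists c; rewrite -e1.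
have hin (Z : At) : h * Z = (w ** Z.1 + Z.2 *: w, 0).
  by congr pair; rewrite /= ?mul0r// scale0r addr0.
pose v := w ** Y.1 + Y.2 *: w.
have fE : h * h * Y = (x ** (star x ** v), 0).
  by rewrite -mulrA !hin /= scale0r addr0 rmulA.
rewrite fE in ff f0; exists (star x ** v); split.
  by have := congr1 fst ff; rewrite /= !scale0r !addr0.
by move=> xv; apply: f0; rewrite xv.
Qed.

End UnitizationAlgebra.

Lemma real_rank_zero_has_idempotent_multiples (R : realType) (A : cstarAlgType R) :
  real_rank_zero A -> has_idempotent_multiples A.
Proof.
rewrite /real_rank_zero; case: asboolP => [[e eP] dense x x0|]; last first.
  exact: unitization_idempotent_multiples.
(* A zero unit would make [A] the zero algebra, which has no nonzero [x]. *)
have e0 : e != 0.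
  by apply/eqP => e0; apply: x0; rewrite -(eP x).1 e0 rmul0l.
exact: (unital_idempotent_multiples eP e0).
Qed.

Theorem corollary10p5 :
  (~ exists X : rng_diagram cube,
       (forall p : cube, regular_rng (X p)) /\ lifts_wrt_V X cube_diagram)
  /\
  (forall R : realType,
     ~ exists X : cstar_diagram cube R,
         (forall p : cube, real_rank_zero (X p)) /\
         lifts_wrt_V (rng_diagram_of_cstar X) cube_diagram).
Proof.
split=> [[X [regX]]|R [X [rrX]]]; apply: cube_diagram_no_lift => p.
  exact/regular_has_idempotent_multiples/regX.
exact/real_rank_zero_has_idempotent_multiples/rrX.
Qed.
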